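(* Let $G$ be a graph of maximum degree $\Delta$ such that for every vertex $u$ the induced subgraph $G[N(u)]$ contains at most $t$ copies of the path $P_{k-1}$ on $k-1$ vertices, where $t\ge1/2$ and $k\ge3$ is an integer. (1) For any $\lambda>0$, \[ \frac{1}{|V(G)|}\frac{\lambda Z_G'(\lambda)}{Z_G(\lambda)}\ \ge\ \sup_{0<x\le\lambda}\ \frac{x}{1+x}\cdot\frac{W\bigl(\Delta(1+x)^{k-3+\sqrt{2t}}\log(1+x)\bigr)}{\Delta(1+x)^{k-3+\sqrt{2t}}\log(1+x)}. \] (2) For any $\varepsilon>0$ there exists $\delta_0$ (depending only on $\varepsilon$) such that $G$ has a fractional colouring in which each $u$ is coloured with a subset of \[ \Bigl[0,\ (1+\varepsilon)\max\Bigl\{\frac{\deg(u)}{\log(\deg(u)/(k+\sqrt t))},\ \frac{\delta_0}{\log\delta_0}(k+\sqrt t)\Bigr\}\Bigr). \] In particular $\chi_f(G)\le(1+o(1))\Delta/\log(\Delta/(k+\sqrt t))$ as $\Delta/(k+\sqrt t)\to\infty$. (3) For any $\varepsilon>0$ there exist $\delta_0,\Delta_0$ (depending only on $\varepsilon$) such that if $\Delta\ge\Delta_0$ and $\mathscr H=(L,H)$ is a cover of $G$ with, for all $u$, \[ |L(u)|\ \ge\ (1+\varepsilon)\max\Bigl\{\frac{\deg(u)}{\log\bigl(\deg(u)/((k+\sqrt t)\log\Delta)\bigr)},\ \frac{\delta_0}{\log\delta_0}(k+\sqrt t)\log\Delta\Bigr\}, \] then $G$ is $\mathscr H$-colourable.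 In particular, if $k+\sqrt t=\Delta^{o(1)}$ then $\chi_c(G)\le(1+o(1))\Delta/\log\Delta$ as $\Delta\to\infty$.
   Context: All graphs are finite and simple; $\log$ is the natural logarithm; $W$ is the principal branch of the Lambert $W$-function (inverse of $x\mapsto xe^x$ on $[-1,\infty)$). A copy of $P_{k-1}$ is a (not necessarily induced) subgraph isomorphic to the path on $k-1$ vertices. $Z_G(\lambda)=\sum_{I}\lambda^{|I|}$ over independent sets of $G$ (including $\varnothing$), $Z_G'$ its derivative. A fractional colouring of $G$ is an assignment $w$ of pairwise disjoint measurable subsets of $[0,\infty)$ to the independent sets of $G$ with $\sum_{I\ni v}|w(I)|=1$ for every vertex $v$; vertex $v$ is coloured with $c(v)=\bigcup_{I\ni v}w(I)$. $\chi_f(G)$ is the least $k$ for which a fractional colouring with all $w(I)\subseteq[0,k)$ exists. A cover of $G$ is a pair $\mathscr H=(L,H)$ where $H$ is a graph and $L:V(G)\to 2^{V(H)}$ is such that: the sets $L(u)$ partition $V(H)$; each $H[L(u)]$ is complete; edges of $H$ between $L(u)$ and $L(v)$, $u\ne v$, exist only if $uv\in E(G)$; and for $uv\in E(G)$ these edges form a matching. An $\mathscr H$-colouring is an independent set of $H$ of size $|V(G)|$. $\chi_c(G)$ is the least $k$ such that $G$ has an $\mathscr H$-colouring for every cover with $|L(u)|=k$ for all $u$. *)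

(* Defs.v *)
From HB Require Import structures.
From mathcomp Require Import all_boot all_order all_algebra.
From mathcomp Require Import all_classical all_reals.
From mathcomp Require Import sequences exp measure lebesgue_measure.
Set Implicit Arguments. Unset Strict Implicit. Unset Printing Implicit Defensive.
Import Order.TTheory GRing.Theory Num.Theory.
Local Open Scope ring_scope.

Definition simple_graph (V : finType) (G : rel V) : Prop :=
  symmetric G /\ irreflexive G.

Definition nbhd (V : finType) (G : rel V) (u : V) : {set V} := [set v | G u v].

Definition deg (V : finType) (G : rel V) (u : V) : nat := #|nbhd G u|.

Definition maxdeg (V : finType) (G : rel V) : nat := \max_(u : V) deg G u.

Definition indep (V : finType) (G : rel V) (I : {set V}) : bool :=
  [forall x in I, forall y in I, ~~ G x y].

(* Copies of the path P_m (on m vertices) in the induced subgraph G[A]: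
   a copy is a (not necessarily induced) subgraph (S, F), S a vertex set and
   F a set of edges (edges = 2-element vertex sets), isomorphic to P_m, i.e.
   the image of an injective map f : 'I_m -> A sending consecutive indices
   to adjacent vertices, with F exactly the images of the m-1 path edges. *)
Definition path_copies (V : finType) (G : rel V) (A : {set V}) (m : nat) : nat :=
  #|[set p : {set V} * {set {set V}} |
      [exists f : {ffun 'I_m -> V},
        [&& injectiveb f,
            [forall i, f i \in A],
            [forall i : 'I_m, forall j : 'I_m, (val j == (val i).+1) ==> G (f i) (f j)]
          & p == ([set f i | i in 'I_m],
                  [set [set f i; f j] | i in 'I_m, j in 'I_m & val j == (val i).+1])]]]|.

Definition indep_poly (R : nzRingType) (V : finType) (G : rel V) : {poly R} :=
  \sum_(I : {set V} | indep G I) 'X^#|I|.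

Local Open Scope classical_set_scope.

(* W y = the unique w >= -1 with w * e^w = y (for y >= -1/e). *)
Definition lambertW (R : realType) (y : R) : R :=
  xget 0 [set w : R | -1 <= w /\ w * expR w = y].

(* z |-> W(z)/z, extended by continuity (value 1) at z = 0 *)
Definition W_ratio (R : realType) (z : R) : R :=
  if z == 0 then 1 else lambertW z / z.

Definition frac_colouring (R : realType) (V : finType) (G : rel V)
    (w : {set V} -> set R) : Prop :=
  [/\ forall I, measurable (w I),
      forall I, w I `<=` [set x : R | 0 <= x],
      forall I, ~~ indep G I -> w I = set0,
      forall I J, I != J -> w I `&` w J = set0
    & forall v : V,
        (\sum_(I : {set V} | indep G I && (v \in I)) (@lebesgue_measure R) (w I)
          = 1)%E ].

Definition colour_of (R : realType) (V : finType) (G : rel V)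
    (w : {set V} -> set R) (v : V) : set R :=
  \bigcup_(I in [set I : {set V} | indep G I /\ v \in I]) w I.

(* fractional chromatic number: least k >= 0 such that a fractional colouring
   with all w(I) in [0,k) exists (the least such k exists; we take the inf). *)
Definition chi_f (R : realType) (V : finType) (G : rel V) : R :=
  inf [set k : R | 0 <= k /\ exists w, frac_colouring G w /\
                    forall I, w I `<=` [set x : R | 0 <= x < k]].

Local Close Scope classical_set_scope.

Definition dp_cover (V HT : finType) (G : rel V) (H : rel HT) (L : V -> {set HT}) : Prop :=
  simple_graph H /\
  [/\ (forall x : HT, exists u, x \in L u),
      (forall u v, u != v -> [disjoint L u & L v]),
      (forall u x y, x \in L u -> y \in L u -> x != y -> H x y),
      (forall u v x y, u != v -> x \in L u -> y \in L v -> H x y -> G u v)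
    & (forall u v, G u v -> forall x, x \in L u -> #|[set y in L v | H x y]| <= 1)%N].

Definition cover_colourable (V HT : finType) (H : rel HT) : Prop :=
  exists I : {set HT}, indep H I /\ #|I| = #|V|.

Definition dp_colourable (V : finType) (G : rel V) (k : nat) : Prop :=
  forall (HT : finType) (H : rel HT) (L : V -> {set HT}),
    dp_cover G H L -> (forall u, #|L u| = k) -> cover_colourable V H.

Local Open Scope classical_set_scope.

Definition chi_c (R : realType) (V : finType) (G : rel V) : R :=
  inf [set x : R | exists k : nat, x = k%:R /\ dp_colourable G k].

Definition local_path_bound (R : realType) (V : finType) (G : rel V) (k : nat) (t : R) : Prop :=
  forall u : V, ((path_copies G (nbhd G u) (k - 1))%:R : R) <= t.

(* Main.v *)
Require Import Defs.
From HB Require Import structures.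
From mathcomp Require Import all_boot all_order all_algebra.
From mathcomp Require Import all_classical all_reals.
From mathcomp Require Import topology normedtype realfun.
From mathcomp Require Import sequences exp measure lebesgue_measure.
From mathcomp Require Import ring lra zify.
Import Order.TTheory GRing.Theory Num.Theory.
Set Implicit Arguments. Unset Strict Implicit. Unset Printing Implicit Defensive.
Local Open Scope ring_scope.

(* By Erdos-Gallai, a graph with more than (k-3)n/2 edges on n vertices contains P_{k-1};
   deleting an edge of each copy in turn, every subgraph of a neighbourhood G[N(u)] has
   average degree at most d = k - 3 + sqrt(2t).  In the hard-core model at fugacity l a
   graph F of average degree d on y vertices satisfies Z_F <= (1+l)^y and, by convexity,
   l Z_F'/Z_F >= l/(1+l) y (1+l)^(-d).  Conditioning a hard-core set I on I \ N(u), this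
   gives beta P(u in I) + gamma E|I cap N(u)| >= 1 for suitable beta and gamma.

   (1) follows by summing over u.
   (2) Run this distribution on the vertices that are not yet fully coloured until one of
   them is; vertex u is then full by time beta_u + gamma_u deg(u).
   (3) Take a hard-core set I in the cover graph.  Call u flawed if it is uncoloured and
   either few colours x of L(u) are free, or some free x has many available neighbours in
   other lists.  The former is unlikely by an exponential moment bound, which combines the
   number of free colours with the sum over x of |I cap N(x)| <= deg(u), and the latter
   because a large sparse graph has a large partition function.  The lopsided local lemma
   removes all flaws, and the remaining lists admit an independent transversal. *)

(** * Degree sums in neighbourhoods with few paths *)

(** The inequality with beta and gamma has two free parameters, the fugacity and a tangent point
    [w]. All vertices share one random set, hence one fugacity, but [w] may vary with the vertex,
    and this is what makes (2) local. In (1) the optimal [w] solves [w e^w = z], whence Lambert's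
    function. In (2) and (3) the fugacity is a small multiple of 1/(k + sqrt t), which keeps (1+l)^d
    close to 1.

    The factor log Delta in (3) is the price of the local lemma. Whether u is flawed depends on I
    near u only, so flaws interact within balls of about Delta^3 vertices and must have probability
    about Delta^-4, even conditionally on the absence of flaws elsewhere. A set F of available
    vertices is avoided with probability 1/Z_F, which is small enough once l|F| is of order log
    Delta, that is, |F| of order (k + sqrt t) log Delta. The colours of L(u) are not independent,
    which rules out a plain concentration bound. But cover edges form matchings, so the
    neighbourhoods of these colours in the other lists are pairwise disjoint and can be integrated
    out one by one. *)

Section ErdosGallai.
Import boot.fintype boot.finset.
Variables (V : finType) (G : rel V).
Hypotheses (Gsym : symmetric G) (Girr : irreflexive G).

Definition degsum (A : {set V}) : nat := \sum_(v in A) #|nbhd G v :&: A|.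

Lemma degsum_le_sqr (A : {set V}) : (degsum A <= #|A| * #|A|)%N.
Proof.
rewrite /degsum -sum_nat_const.
by apply: leq_sum => v _; rewrite subset_leq_card // subsetIr.
Qed.

Lemma degsumD1 (A : {set V}) v : v \in A ->
  degsum A = (degsum (A :\ v) + (#|nbhd G v :&: A|).*2)%N.
Proof.
move=> vA; rewrite /degsum (big_setD1 v) //= -addnn addnC addnA; congr addn.
rewrite -[#|nbhd G v :&: A|]sum1_card.
have -> : (\sum_(x in nbhd G v :&: A) 1 = \sum_(x in A :\ v) G v x)%N.
  rewrite [RHS]big_mkcond [LHS]big_mkcond; apply: eq_bigr => x _.
  rewrite !inE; case: eqP => [->|_] /=; first by rewrite Girr.
  by case: (x \in A); case: (G v x).
rewrite -big_split /=; apply: eq_bigr => x /setD1P[xv xA].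
have -> : nbhd G x :&: A = (if G v x then [set v] else set0) :|: (nbhd G x :&: (A :\ v)).
  apply/setP => y; rewrite !inE; have [->|yv] := eqVneq y v.
    by rewrite vA Gsym andbT andbF orbF; case: ifP; rewrite !inE ?eqxx.
  by case: ifP => _; rewrite !inE ?(negPf yv).
case: ifP => _; last by rewrite set0U addn0.
by rewrite cardsU1 !inE eqxx /= andbF addnC.
Qed.

Lemma degsum_closed (A C : {set V}) : C \subset A ->
  (forall x y, x \in C -> y \in A -> G x y -> y \in C) ->
  degsum A = (degsum C + degsum (A :\: C))%N.
Proof.
move=> CA Ccl; rewrite /degsum (big_setID C) /= (setIidPr CA); congr addn.
  apply: eq_bigr => x xC; congr #|pred_of_set _|; apply/setP => y; rewrite !inE.
  case Gxy: (G x y) => //=; apply/idP/idP => [yA|/(subsetP CA)//].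
  exact: Ccl Gxy.
apply: eq_bigr => x /setDP[xA xC]; congr #|pred_of_set _|; apply/setP => y; rewrite !inE.
case Gxy: (G x y) => //=; case yC: (y \in C) => //=; apply: contraNF xC => _.
by apply: (Ccl y) => //; rewrite Gsym.
Qed.

Lemma degsum_complete_bound (A : {set V}) n : (#|A| <= n.+1)%N -> (degsum A <= n * #|A|)%N.
Proof.
move=> An; rewrite /degsum mulnC -sum_nat_const; apply: leq_sum => v vA.
have : nbhd G v :&: A \subset A :\ v.
  apply/subsetP => y; rewrite !inE => /andP[Gvy ->]; rewrite andbT.
  by apply: contraTneq Gvy => ->; rewrite Girr.
move/subset_leq_card/leq_trans; apply.
by move: An; rewrite (cardsD1 v) vA add1n ltnS.
Qed.

Definition gpath (A : {set V}) (s : seq V) :=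
  [&& uniq s, sorted G s & all (mem A) s].

(** The rotation argument of Dirac and Ore. A longest path contains all neighbours of its ends [x]
    and [b]. If an edge of the path has its far end adjacent to [x] and its near end adjacent to
    [b], reversing the part after it closes the path into a cycle. *)
Lemma maximal_path_rotation A x s m :
  gpath A (x :: s) -> (forall s', gpath A s' -> (size s' <= (size s).+1)%N) ->
  (forall v, v \in A -> (m <= (#|nbhd G v :&: A|).*2)%N) -> (size s < m)%N ->
  exists c, [/\ perm_eq c (x :: s) & cycle G c].
Proof.
set b := last x s => /and3P[us ps As] smax dm sm.
have nx y : y \in A -> G x y -> y \in s.
  move=> yA Gxy; suff: y \in x :: s.
    by rewrite inE => /orP[/eqP yx|//]; move: Gxy; rewrite yx Girr.
  apply/negPn/negP => yn; have /smax : gpath A [:: y, x & s].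
    apply/and3P; split.
    - by rewrite cons_uniq yn.
    - by rewrite /= Gsym Gxy.
    - by rewrite /= yA.
  by rewrite /= ltnn.
have nb y : y \in A -> G b y -> y \in x :: s.
  move=> yA Gby; apply/negPn/negP => yn; have /smax : gpath A (rcons (x :: s) y).
    apply/and3P; split; rewrite ?rcons_uniq ?yn //.
      by rewrite /= rcons_path -/b Gby andbT.
    by rewrite all_rcons As andbT.
  by rewrite size_rcons ltnn.
have xA : x \in A by case/andP: As.
have bA : b \in A by move/allP: As => /(_ b); apply; exact: mem_last.
(* Index [i] stands for the edge from [nth x (x :: s) i] to [nth x s i]. There are [size s < m]
   edges, while the degrees of the two ends add up to at least [m], so [S] and [T] meet. *)
pose S := [set i : 'I_(size s) | G x (nth x s i)].
pose T := [set i : 'I_(size s) | G b (nth x (x :: s) i)].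
have dS : (#|nbhd G x :&: A| <= #|S|)%N.
  apply: leq_trans (leq_imset_card (fun i : 'I__ => nth x s i) S).
  apply/subset_leq_card/subsetP => y; rewrite !inE => /andP[Gxy yA].
  have ys := nx _ yA Gxy; have ys' := ys; rewrite -index_mem in ys'.
  by apply/imsetP; exists (Ordinal ys') => /=; rewrite ?inE /= nth_index.
have dT : (#|nbhd G b :&: A| <= #|T|)%N.
  apply: leq_trans (leq_imset_card (fun i : 'I__ => nth x (x :: s) i) T).
  apply/subset_leq_card/subsetP => y; rewrite !inE => /andP[Gby yA].
  have ys := nb _ yA Gby; have ys' := ys; rewrite -index_mem in ys'.
  have yb : y != b by apply: contraTneq Gby => ->; rewrite Girr.
  have ib : (index y (x :: s) < size s)%N.
    rewrite /= in ys'; rewrite ltn_neqAle -ltnS ys' andbT.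
    apply: contra yb => /eqP e; rewrite -(nth_index x ys) e /b.
    by rewrite -[X in last X]/x (last_nth x).
  by apply/imsetP; exists (Ordinal ib); rewrite ?inE nth_index.
have [i] : exists i, i \in S :&: T.
  apply/set0Pn; rewrite -card_gt0.
  have := cardsUI S T; have := subset_leq_card (subsetT (S :|: T)); rewrite cardsT card_ord.
  have := dm _ xA; have := dm _ bA; lia.
rewrite !inE => /andP[Gi1 Gi2].
exists (take i.+1 (x :: s) ++ rev (drop i.+1 (x :: s))); split.
  rewrite -{3}(cat_take_drop i.+1 (x :: s)) perm_cat2l.
  by rewrite perm_rev.
have iss : (i < size s)%N by [].
rewrite /= (drop_nth x iss).
set y := nth x s i in Gi1 *; set d := drop i.+1 s.
have ld : last y d = b by rewrite /b -(cat_take_drop i s) last_cat (drop_nth x iss).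
have lt : last x (take i s) = nth x (x :: s) i.
  rewrite (last_nth x) size_take iss.
  by case: (i : nat) iss => [|j] //= js; rewrite nth_take.
have pd : path G y d.
  move: ps; rewrite /= -(cat_take_drop i s) cat_path => /andP[_].
  by rewrite (drop_nth x iss) /= => /andP[].
rewrite rcons_cat cat_path take_path //= lt.
have -> : rcons (rev (y :: d)) x = b :: rcons (rev (belast y d)) x.
  by rewrite lastI ld rev_rcons rcons_cons.
rewrite /= Gsym Gi2 /= rcons_path.
have -> : path G b (rev (belast y d)).
  rewrite -ld rev_path; apply: sub_path pd => u v; by rewrite Gsym.
rewrite Gsym; suff -> : last b (rev (belast y d)) = y by [].
by rewrite -ld; case: (d) => //= z e; rewrite rev_cons last_rcons.
Qed.

(** Induction on [A]: a vertex of degree at most [n / 2] is deleted, which costs at most [n].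
    Otherwise a longest path spans a cycle, whose vertices form a component of at most [n.+1]
    vertices, and this component is split off. *)
Lemma erdos_gallai n (A : {set V}) :
  (forall s, gpath A s -> (size s <= n.+1)%N) -> (degsum A <= n * #|A|)%N.
Proof.
elim/(well_founded_induction (Wf_nat.well_founded_ltof _ (fun A : {set V} => #|A|))): A.
rewrite /Wf_nat.ltof => A IH0 nolong.
have IH (B : {set V}) : B \proper A -> (degsum B <= n * #|B|)%N.
  move=> BA; apply: IH0; first by apply/ssrnat.ltP; apply: proper_card.
  move=> s /and3P[us ps /allP sB]; apply: nolong; apply/and3P; split=> //.
  by apply/allP => y /sB; apply: (subsetP (proper_sub BA)).
have [->|[a aA]] := set_0Vmem A; first by rewrite /degsum big_set0.
have [/exists_inP[v vA dv]|] := boolP [exists v in A, ((#|nbhd G v :&: A|).*2 <= n)%N].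
  rewrite (degsumD1 vA) [#|A|](cardsD1 v) vA mulnDr muln1 addnC leq_add //.
  by apply: IH; rewrite properD1.
rewrite negb_exists_in => /forall_inP dm.
have {}dm v : v \in A -> (n.+1 <= (#|nbhd G v :&: A|).*2)%N.
  by move=> /dm; rewrite -ltnNge.
have [x [s [gs smax]]] : exists x s, gpath A (x :: s) /\
    (forall s', gpath A s' -> (size s' <= (size s).+1)%N).
  have P1 : exists k, [exists s : k.-tuple V, gpath A s].
    exists 1%N; apply/existsP; exists [tuple a]; rewrite /gpath /= andbT.
    exact: aA.
  have P2 k : [exists s : k.-tuple V, gpath A s] -> (k <= n.+1)%N.
    by move=> /existsP[s /nolong]; rewrite size_tuple.
  case: (ex_maxnP P1 P2) => k /existsP[[s /= /eqP sk] gs] kmax.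
  case: s sk gs => [/= k0|x s sk gs].
    have : (1 <= k)%N.
      by apply: kmax; apply/existsP; exists [tuple a]; rewrite /gpath /= andbT; exact: aA.
    by rewrite -k0.
  exists x, s; split => // s' gs'; rewrite -[(size s).+1]/(size (x :: s)) sk.
  by apply: kmax; apply/existsP; exists (in_tuple s').
have sn : (size s < n.+1)%N by exact: (nolong _ gs).
have [c [cs cG]] := maximal_path_rotation gs smax dm sn.
case/and3P: (gs) => us _ /allP sA.
pose C := [set y in x :: s].
have CA : C \subset A by apply/subsetP => y; rewrite in_set; apply: sA.
(* Opening the cycle at [v] and prepending an outside neighbour [w] would give a longer path. *)
have Ccl v w : v \in C -> w \in A -> G v w -> w \in C.
  rewrite !in_set -!(perm_mem cs) => vc wA Gvw; apply/negPn/negP => wc.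
  have [i c' ec] := rot_to vc.
  have /smax : gpath A [:: w, v & c'].
    apply/and3P; split.
    - by rewrite cons_uniq -ec rot_uniq (perm_uniq cs) mem_rot wc.
    - rewrite /= Gsym Gvw /=.
      by move: cG; rewrite -(rot_cycle i) ec /= rcons_path => /andP[].
    - apply/allP => y; rewrite inE => /orP[/eqP ->//|].
      by rewrite -ec mem_rot (perm_mem cs); apply: sA.
  by rewrite -[size (w :: _)]/(size (v :: c')).+1 -ec size_rot (perm_size cs) ltnn.
rewrite (degsum_closed CA Ccl) -(cardsID C A) (setIidPr CA) mulnDr leq_add //.
  by apply: degsum_complete_bound; rewrite /C cardsE; apply: leq_trans (card_size _) _.
apply: IH.
rewrite properE subsetDl /=; apply/negP => /subsetP /(_ x (sA x (mem_head _ _))).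
by rewrite !inE eqxx.
Qed.

End ErdosGallai.

(** * Deleting edges of path copies; the sparsity constant *)

Section PathCopies.
Import boot.fintype boot.finset.
Variable (V : finType).

Lemma path_copiesS (G : rel V) (A B : {set V}) m :
  A \subset B -> (path_copies G A m <= path_copies G B m)%N.
Proof.
move=> AB; apply/subset_leq_card/subsetP => p; rewrite !inE => /existsP[f].
case/and4P => f1 /forallP f2 f3 f4; apply/existsP; exists f.
apply/and4P; split=> //.
by apply/forallP => i; apply: (subsetP AB).
Qed.

Definition del_edge (G : rel V) (a b : V) : rel V :=
  fun x y => G x y && ([set x; y] != [set a; b]).

Lemma set2_eqE (x y a b : V) :
  [set x; y] = [set a; b] -> (x = a /\ y = b) \/ (x = b /\ y = a).
Proof.
move=> e; have /set2P xab : x \in [set a; b] by rewrite -e set21.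
have /set2P yab : y \in [set a; b] by rewrite -e set22.
have /set2P axy : a \in [set x; y] by rewrite e set21.
have /set2P bxy : b \in [set x; y] by rewrite e set22.
intuition congruence.
Qed.

Lemma degsum_del_edge (G : rel V) (A : {set V}) a b :
  a != b -> (degsum G A <= degsum (del_edge G a b) A + 2)%N.
Proof.
move=> ab; rewrite /degsum.
have -> : 2%N = (\sum_(v in [set a; b]) 1)%N by rewrite sum1_card cards2 ab.
apply: (@leq_trans (\sum_(v in A) (#|nbhd (del_edge G a b) v :&: A| + (v \in [set a; b])))).
  apply: leq_sum => v _.
  have sub (c : V) : nbhd G v :&: A \subset (nbhd (del_edge G a b) v :&: A) :|:
      (if v == a then [set b] else if v == b then [set a] else set0).
    apply/subsetP => y; rewrite !inE => /andP[Gvy ->]; rewrite /del_edge Gvy andbT /=.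
    case: (altP ([set v; y] =P [set a; b])) => //= /set2_eqE.
    by case=> -[-> ->]; rewrite eqxx ?inE // eq_sym (negPf ab) inE.
  apply: leq_trans (subset_leq_card (sub a)) _; apply: leq_trans (leq_card_setU _ _) _.
  by rewrite leq_add2l !inE; case: (v == a); case: (v == b); rewrite ?cards1 ?cards0.
rewrite big_split /= leq_add2l (big_mkcond (fun v => v \in A)) (big_mkcond (fun v => v \in [set _; _])).
by apply: leq_sum => v _; case: (v \in A); case: (v \in [set a; b]).
Qed.

(** The edge removed is the first one of [s]. The initial segment of [s] on [n.+2] vertices is a
    copy using it, and a copy records its edge set, so it cannot reappear through another map. *)
Lemma path_copies_del_edge (G : rel V) (A : {set V}) n s :
  gpath G A s -> (n.+2 <= size s)%N ->
  exists a b, [/\ G a b, a != b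
    & (path_copies (del_edge G a b) A n.+2 < path_copies G A n.+2)%N].
Proof.
case/and3P => us ps /allP As ns.
case: s us ps As ns => // a [//|b s] us ps As ns.
have /andP[Gab ps'] := ps.
have ab : a != b by move: us; rewrite /= inE negb_or -!andbA => /and4P[].
exists a, b; split=> //; apply: proper_card; apply/properP; split.
  apply/subsetP => p; rewrite !inE => /existsP[f] /and4P[f1 f2 f3 f4].
  apply/existsP; exists f; apply/and4P; split=> //.
  apply/forallP => i; apply/forallP => j; apply/implyP => ij.
  by move/forallP: f3 => /(_ i)/forallP/(_ j); rewrite ij => /= /andP[].
pose f := [ffun i : 'I_n.+2 => nth a [:: a, b & s] i].
exists ([set f i | i in 'I_n.+2],
   [set [set f i; f j] | i in 'I_n.+2, j in 'I_n.+2 & val j == (val i).+1]).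
  rewrite inE; apply/existsP; exists f; rewrite eqxx andbT; apply/and3P; split.
  - apply/injectiveP => i j; rewrite !ffunE => /eqP.
    rewrite nth_uniq ?(leq_trans (ltn_ord _) ns) // => /eqP ij; exact: val_inj.
  - by apply/forallP => i; rewrite ffunE; apply/As/mem_nth/(leq_trans (ltn_ord _) ns).
  - apply/forallP => i; apply/forallP => j; apply/implyP => /eqP /= ij; rewrite !ffunE ij.
    move/(pathP a): ps => /(_ i); apply.
    by have := ltn_ord j; rewrite ij /= => /leq_trans/(_ ns).
rewrite inE; apply/negP => /existsP[g /and4P[_ _ /forallP g3 /eqP[_ eF]]].
have : [set a; b] \in [set [set f i; f j] | i in 'I_n.+2, j in 'I_n.+2 & val j == (val i).+1].
  have n1 : (1 < n.+2)%N by [].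
  apply/imset2P; exists ord0 (Ordinal n1); rewrite ?inE //.
  by rewrite !ffunE.
rewrite eF => /imset2P[i j _]; rewrite inE => ij e.
by move/forallP: (g3 i) => /(_ j); rewrite ij /del_edge e eqxx andbF.
Qed.

(* Deleting an edge of a copy of the path destroys that copy and creates none. *)
Lemma degsum_path_copies (G : rel V) (A : {set V}) n :
  symmetric G -> irreflexive G ->
  (degsum G A <= n * #|A| + 2 * path_copies G A n.+2)%N.
Proof.
move: {2}(path_copies G A n.+2) (leqnn (path_copies G A n.+2)) => c.
elim: c G => [|c IH] G cG Gsym Girr.
all: have [long|short] := pselect (exists2 s, gpath G A s & (n.+2 <= size s)%N); last first.
1,3: apply: leq_trans (leq_addr _ _); apply: erdos_gallai => // s gs.
1,2: by rewrite leqNgt; apply/negP => sn; apply: short; exists s.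
all: have [s gs sn] := long; have [a [b [Gab ab lt]]] := path_copies_del_edge gs sn.
  by move: lt; rewrite ltnNge (leq_trans cG).
have := IH (del_edge G a b); have := degsum_del_edge G A ab.
have del_sym : symmetric (del_edge G a b) by move=> x y; rewrite /del_edge Gsym setUC.
have del_irr : irreflexive (del_edge G a b) by move=> x; rewrite /del_edge Girr.
move=> h /(_ _ del_sym del_irr); lia.
Qed.

End PathCopies.

Section Sparse.
Import boot.fintype boot.finset.
Variables (R : realType) (V : finType) (G : rel V) (k : nat) (t : R).
Hypotheses (sG : simple_graph G) (k3 : (3 <= k)%N) (lp : local_path_bound G k t).

(** Two bounds are available with y = |A|: y^2, and (k-3)y + 2t. They are balanced at y = sqrt(2t):
    below it y^2 is at most sqrt(2t) y, above it 2t is. *)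
Lemma local_path_bound_degsum (u : V) (A : {set V}) : A \subset nbhd G u ->
  (degsum G A)%:R <= (k%:R - 3 + Num.sqrt (2 * t)) * #|A|%:R :> R.
Proof.
move=> Au; have [Gsym Girr] := sG.
have := degsum_path_copies A (k - 3) Gsym Girr.
have -> : (k - 3).+2 = (k - 1)%N by lia.
have pc : (path_copies G A (k - 1))%:R <= t.
  by apply: le_trans (lp u); rewrite ler_nat path_copiesS.
rewrite -(ler_nat R) natrD !natrM (natrB _ k3) => h1.
have := degsum_le_sqr G A; rewrite -(ler_nat R) natrM => h2.
have t0 : 0 <= t by apply: le_trans pc.
have s2 : Num.sqrt (2 * t) * Num.sqrt (2 * t) = 2 * t by rewrite -expr2 sqr_sqrtr // mulr_ge0.
have s0 : 0 <= Num.sqrt (2 * t) by rewrite sqrtr_ge0.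
have k0 : 0 <= k%:R - 3 :> R by rewrite subr_ge0 ler_nat.
have y0 : 0 <= #|A|%:R :> R by [].
have [sy|sy] := leP (Num.sqrt (2 * t)) #|A|%:R; nra.
Qed.

End Sparse.

(** * The hard-core model *)

Section HardCore.
Import boot.fintype boot.finset.
Variables (R : realType) (T : finType) (E : rel T).
Hypotheses (Esym : symmetric E) (Eirr : irreflexive E).
Implicit Types (A B I J K S : {set T}) (l mu r w d : R).

(** Weights stay unnormalised: [Zs l A] is the partition function of the graph induced on [A],
    [Ms l A / Zs l A] its mean number of occupied vertices, and probability bounds appear multiplied
    by the partition function. *)
Definition hc l I : R := (indep E I)%:R * l ^+ #|I|.
Definition Zs l A : R := \sum_(I : {set T} | I \subset A) hc l I.
Definition Ms l A : R := \sum_(I : {set T} | I \subset A) hc l I * #|I|%:R.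
Definition avail J A : {set T} := [set y in A | [forall x in J, ~~ E y x]].

Lemma in_avail J A y : (y \in avail J A) = (y \in A) && [forall x in J, ~~ E y x].
Proof. by rewrite in_set. Qed.

Lemma avail_sub J A : avail J A \subset A.
Proof. by apply/subsetP => y; rewrite in_avail => /andP[]. Qed.

Lemma hc_ge0 l I : 0 <= l -> 0 <= hc l I.
Proof. by move=> l0; rewrite mulr_ge0 ?exprn_ge0. Qed.

Lemma indep0 : indep E set0.
Proof. by apply/forall_inP => x; rewrite inE. Qed.

Lemma indepS A B : A \subset B -> indep E B -> indep E A.
Proof.
move=> /subsetP AB /forall_inP iB; apply/forall_inP => x /AB/iB /forall_inP h.
by apply/forall_inP => y /AB/h.
Qed.

Lemma indepU J K A : K \subset A ->
  indep E (J :|: K) = [&& indep E J, indep E K & K \subset avail J A].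
Proof.
move=> KA; apply/idP/and3P => [i|[/forall_inP iJ /forall_inP iK /subsetP KF]].
  split; [exact: indepS (subsetUl _ _) i|exact: indepS (subsetUr _ _) i|].
  apply/subsetP => y yK; rewrite inE (subsetP KA) //=; apply/forall_inP => x xJ.
  have /forall_inP/(_ y) := i; rewrite inE yK orbT => /(_ isT)/forall_inP/(_ x).
  by rewrite inE xJ; apply.
have JK x y : x \in J -> y \in K -> ~~ E y x.
  by move=> xJ /KF; rewrite inE => /andP[_ /forall_inP]; apply.
apply/forall_inP => x /setUP[xJ|xK]; apply/forall_inP => y /setUP[yJ|yK].
- by have /forall_inP := iJ x xJ; apply.
- by rewrite Esym JK.
- exact: JK.
- by have /forall_inP := iK x xK; apply.
Qed.

Lemma hcU l J K A : J \subset ~: A -> K \subset A ->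
  hc l (J :|: K) = hc l J * (hc l K * (K \subset avail J A)%:R).
Proof.
move=> JA KA; rewrite /hc (indepU _ KA) cardsU.
have -> : J :&: K = set0.
  apply/setP => x; rewrite !inE; apply/negP => /andP[/(subsetP JA)].
  by rewrite inE => /negP xA /(subsetP KA).
rewrite cards0 subn0 exprD; case: (indep E J); case: (indep E K); case: (K \subset _) => /=; ring.
Qed.

Lemma sum_setU (F : {set T} -> R) A :
  \sum_I F I = \sum_(J : {set T} | J \subset ~: A) \sum_(K : {set T} | K \subset A) F (J :|: K).
Proof.
rewrite (partition_big (fun I => I :\: A) (fun J => J \subset ~: A)) /=; last first.
  by move=> I _; rewrite setDE subsetIr.
apply: eq_bigr => J JA.
have JA0 : J :&: A = set0.
  by apply/eqP; rewrite setI_eq0 -[A]setCK -subsets_disjoint.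
rewrite (reindex_onto (fun K => J :|: K) (fun I => I :&: A)) /=; last first.
  by move=> I /eqP <-; rewrite setUC setID.
apply: eq_bigl => K; rewrite setDUl setIUl JA0 set0U.
apply/andP/idP => [[_ /eqP/setIidPl //]|KA].
have /eqP -> : K :\: A == set0 by rewrite setD_eq0.
by rewrite setU0 (setIidPl KA) setDE (setIidPl JA) !eqxx.
Qed.

Lemma sum_avail l J A (F : {set T} -> R) : J \subset ~: A ->
  \sum_(K : {set T} | K \subset A) hc l (J :|: K) * F K =
  hc l J * \sum_(K : {set T} | K \subset avail J A) hc l K * F K.
Proof.
move=> JA; rewrite mulr_sumr [RHS]big_mkcond [LHS]big_mkcond; apply: eq_bigr => K _.
case: ifP => KA; first by rewrite (hcU _ JA KA); case: ifP => _ /=; ring.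
case: ifP => // KF; move: KA; suff -> : K \subset A by [].
exact: subset_trans KF (avail_sub J A).
Qed.

(* The spatial Markov property: given [J = I :\: A], the rest of [I] is a hard-core
   set on the vertices of [A] with no neighbour in [J]. *)
Lemma hc_cond_ge0 l A (g h : {set T} -> R) : 0 <= l ->
  (forall J, J \subset ~: A -> indep E J ->
     0 <= \sum_(K : {set T} | K \subset avail J A) hc l K * h (J :|: K)) ->
  (forall I, 0 <= g I) ->
  (forall J K, J \subset ~: A -> K \subset A -> g (J :|: K) = g J) ->
  0 <= \sum_I hc l I * (g I * h I).
Proof.
move=> l0 hh g0 gA; rewrite (sum_setU _ A); apply: sumr_ge0 => J JA.
under eq_bigr => K KA do rewrite gA //.
rewrite (sum_avail l (fun K => g J * h (J :|: K)) JA).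
have -> : \sum_(K : {set T} | K \subset avail J A) hc l K * (g J * h (J :|: K)) =
   g J * \sum_(K : {set T} | K \subset avail J A) hc l K * h (J :|: K).
  by rewrite mulr_sumr; apply: eq_bigr => K _; ring.
have [iJ|/negPf iJ] := boolP (indep E J); last by rewrite /hc iJ !mul0r.
apply: mulr_ge0; first exact: hc_ge0.
by apply: mulr_ge0; [exact: g0 | exact: hh].
Qed.

Lemma hcU1 l v K : v \notin K ->
  hc l (v |: K) = l * (hc l K * (K \subset ~: nbhd E v)%:R).
Proof.
move=> vK; have Kv : K \subset [set~ v] by rewrite subsetC sub1set inE.
have := hcU l (A := [set~ v]) (J := [set v]) (K := K); rewrite setCK.
move=> /(_ (subxx _) Kv) ->; congr (_ * (_ * _%:R)).
  rewrite /hc cards1 expr1 (_ : indep E [set v]) ?mul1r //.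
  by apply/forall_inP => x /set1P ->; apply/forall_inP => y /set1P ->; rewrite Eirr.
congr nat_of_bool; apply/subsetP/subsetP => sub y yK.
  have := sub y yK; rewrite !inE => /andP[_ /forall_inP/(_ v)]; rewrite set11 Esym; exact.
have := sub y yK; rewrite !inE (memPn vK) //= => Evy.
by apply/forall_inP => x /set1P ->; rewrite Esym.
Qed.

Lemma sum_hc_mem l v A : v \in A ->
  \sum_(I : {set T} | (I \subset A) && (v \in I)) hc l I =
  l * Zs l (A :\ v :\: nbhd E v).
Proof.
move=> vA; rewrite (reindex_onto (fun K => v |: K) (fun I => I :\ v)) /=; last first.
  by move=> I /andP[_ vI]; rewrite setD1K.
rewrite mulr_sumr [RHS]big_mkcond [LHS]big_mkcond; apply: eq_bigr => K _.
rewrite setU11 andbT subUset sub1set vA /= subsetD subsetD1 -!andbA.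
have [vK|vK] /= := boolP (v \in K).
  rewrite !andbF (_ : (v |: K) :\ v == K = false) ?andbF //.
  by apply/negP => /eqP e; move: vK; rewrite -e !inE eqxx.
rewrite setU1K // eqxx andbT hcU1 //.
case: (K \subset A) => //=; rewrite -[nbhd E v in RHS]setCK -subsets_disjoint.
by case: ifP => _ /=; ring.
Qed.

Lemma Zs_rec l v A : v \in A ->
  Zs l A = Zs l (A :\ v) + l * Zs l (A :\ v :\: nbhd E v).
Proof.
move=> vA; rewrite -sum_hc_mem // /Zs (bigID (fun I => v \in I)) /= addrC; congr (_ + _).
by apply: eq_bigl => I; rewrite subsetD1.
Qed.

Lemma Zs_ge0 l A : 0 <= l -> 0 <= Zs l A.
Proof. by move=> l0; apply: sumr_ge0 => I _; apply: hc_ge0. Qed.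

Lemma Zs_ge1 l A : 0 <= l -> 1 <= Zs l A.
Proof.
move=> l0; rewrite /Zs (bigD1 set0) ?sub0set //= /hc indep0 cards0 mulr1.
by rewrite lerDl; apply: sumr_ge0 => I _; apply: hc_ge0.
Qed.

Lemma Zs_gt0 l A : 0 <= l -> 0 < Zs l A.
Proof. by move=> l0; apply: lt_le_trans (Zs_ge1 A l0). Qed.

Lemma Zs_mono l A B : 0 <= l -> A \subset B -> Zs l A <= Zs l B.
Proof.
move=> l0 AB; rewrite /Zs [leRHS](bigID (fun I => I \subset A)) /=.
rewrite [X in _ <= X + _](eq_bigl (fun I => I \subset A)); last first.
  by move=> I; apply: andb_idl => /subset_trans; apply.
by rewrite lerDl; apply: sumr_ge0 => I _; apply: hc_ge0.
Qed.

Lemma Zs0 l : Zs l set0 = 1.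
Proof.
rewrite /Zs (big_pred1 set0) => [|I /=]; last by rewrite subset0.
by rewrite /hc indep0 cards0 mulr1.
Qed.

Lemma Zs_setD l A B : 0 <= l -> Zs l A <= (1 + l) ^+ #|B :&: A| * Zs l (A :\: B).
Proof.
move=> l0; move: {2}#|_| (erefl #|B :&: A|) => n; elim: n A => [|n IH] A en.
  rewrite en mul1r; suff -> : A :\: B = A by [].
  by apply/setDidPl; rewrite -setI_eq0 setIC -cards_eq0 en.
have /card_gt0P[v] : (0 < #|B :&: A|)%N by rewrite en.
rewrite inE => /andP[vB vA].
have e : B :&: (A :\ v) = (B :&: A) :\ v by rewrite setIDA.
have en' : #|B :&: (A :\ v)| = n.
  by apply/eqP; rewrite -eqSS -en e [eqbRHS](cardsD1 v) inE vB vA.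
rewrite en exprS -mulrA; have := IH _ en'; rewrite en'.
have -> : A :\ v :\: B = A :\: B.
  by rewrite setDDl; congr (_ :\: _); apply/setUidPr; rewrite sub1set.
move=> h; apply: le_trans (ler_wpM2l _ h); last by rewrite addr_ge0.
rewrite (Zs_rec l vA) mulrDl mul1r lerD2l ler_wpM2l //.
by apply: Zs_mono; rewrite // subsetDl.
Qed.

Lemma Zs_le l A : 0 <= l -> Zs l A <= (1 + l) ^+ #|A|.
Proof. by move=> /(Zs_setD A A); rewrite setIid setDv Zs0 mulr1. Qed.

(** Once its neighbours are removed, [v] is isolated and contributes the factor [1 + l]. *)
Lemma Zs_nbhd l v A : v \in A ->
  Zs l (A :\: nbhd E v) = (1 + l) * Zs l (A :\ v :\: nbhd E v).
Proof.
move=> vA; rewrite (@Zs_rec _ v) ?inE ?Eirr //.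
have -> : A :\: nbhd E v :\ v = A :\ v :\: nbhd E v by rewrite !setDDl setUC.
have -> : A :\ v :\: nbhd E v :\: nbhd E v = A :\ v :\: nbhd E v by rewrite setDDl setUid.
by rewrite mulrDl mul1r.
Qed.

Lemma Ms_sum l A : Ms l A = \sum_(v in A) l * Zs l (A :\ v :\: nbhd E v).
Proof.
rewrite /Ms; under eq_bigr => I _ do rewrite -sum1_card natr_sum mulr_sumr.
rewrite (exchange_big_dep (fun v => v \in A)) /=; last first.
  by move=> I v /subsetP; apply.
by apply: eq_bigr => v vA; rewrite -sum_hc_mem //; apply: eq_bigr => I _; rewrite mulr1.
Qed.

Lemma expR_lnX l n : 0 <= l -> (1 + l) ^+ n = expR (n%:R * ln (1 + l)).
Proof.
by move=> l0; rewrite expRM_natl lnK // posrE ltr_wpDr.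
Qed.

(** Emptying the neighbourhood of [v] costs at most a factor (1+l) per neighbour, and [v] is then
    occupied with probability l/(1+l). The sum over [v] is bounded by the tangent of the exponential
    at degree [d], whose linear part has the right sign because the average degree is at most
    [d]. *)
Lemma Ms_ge l d A : 0 < l -> (degsum E A)%:R <= d * #|A|%:R ->
  l / (1 + l) * (#|A|%:R * expR (- (d * ln (1 + l)))) * Zs l A <= Ms l A.
Proof.
move=> l0 dA; have l0' := ltW l0; set L := ln (1 + l).
have L0 : 0 <= L by rewrite ln_ge0 // lerDl.
rewrite Ms_sum.
apply: (@le_trans _ _ (\sum_(v in A) l / (1 + l) * expR (- (#|nbhd E v :&: A|%:R * L)) * Zs l A)).
  rewrite -!mulr_suml -mulr_sumr ler_wpM2r ?Zs_ge0 // ler_wpM2l ?divr_ge0 ?addr_ge0 //.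
  apply: (@le_trans _ _ (\sum_(v in A) expR (- (d * L)) * (1 - L * (#|nbhd E v :&: A|%:R - d)))).
    rewrite -mulr_sumr mulrC ler_wpM2l ?expR_ge0 // sumrB sumr_const -mulr_sumr sumrB sumr_const.
    rewrite -natr_sum -/(degsum E A) -[d *+ _]mulr_natr lerBrDr gerDl.
    by rewrite mulr_ge0_le0 // subr_le0.
  apply: ler_sum => v _; have -> : - (#|nbhd E v :&: A|%:R * L) =
     - (d * L) + (- (L * (#|nbhd E v :&: A|%:R - d))) by ring.
  by rewrite expRD ler_wpM2l ?expR_ge0 // expR_ge1Dx.
apply: ler_sum => v vA; rewrite -mulrA -[X in X <= _]mulrA ler_wpM2l // expRN -expR_lnX //.
rewrite ler_pdivrMl ?ltr_wpDr // ler_pdivrMl ?exprn_gt0 ?ltr_wpDr // -Zs_nbhd //.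
exact: Zs_setD.
Qed.

(* The coefficients are those of the tangent at [|A| ln(1 + l) = w]; it remains to use
   [e^x >= 1 + x] at [x = w - |A| ln(1 + l)]. *)
Lemma local_occupancy l w d A : 0 < l -> 0 <= w -> (degsum E A)%:R <= d * #|A|%:R ->
  Zs l A <= expR w / (1 + w) +
    (1 + l) / l * ln (1 + l) * expR (d * ln (1 + l)) / (1 + w) * Ms l A.
Proof.
move=> l0 w0 dA; have l0' := ltW l0; have := Ms_ge l0 dA; set L := ln (1 + l).
have L0 : 0 <= L by rewrite ln_ge0 // lerDl.
have := Zs_le A l0'; rewrite expR_lnX // -/L; have := Zs_gt0 A l0'.
set Z := Zs l A; set M := Ms l A; set y := #|A|%:R => Z0 ZL MZ.
have p1 : 0 < 1 + l by rewrite ltr_wpDr.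
have p2 : 0 < 1 + w by rewrite ltr_wpDr.
have h1 : y * L * Z <= (1 + l) / l * L * expR (d * L) * M.
  rewrite expRN in MZ.
  have -> : y * L * Z =
    (1 + l) / l * L * expR (d * L) * (l / (1 + l) * (y * (expR (d * L))^-1) * Z).
    by field; rewrite !gt_eqF ?expR_gt0.
  by rewrite ler_wpM2l // !mulr_ge0 ?expR_ge0 ?invr_ge0 // ltW.
have h2 : (1 + w - y * L) * Z <= expR w.
  apply: (@le_trans _ _ (expR (w - y * L) * Z)).
    by rewrite ler_wpM2r // ?(ltW Z0) //; have := expR_ge1Dx (w - y * L); rewrite addrA.
  by rewrite expRB mulrAC ler_pdivrMr ?expR_gt0 // ler_wpM2l ?expR_ge0.
rewrite [X in _ + X]mulrAC -mulrDl ler_pdivlMr //; lra.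
Qed.

Lemma vertex_occupancy l w d S u : 0 < l -> 0 <= w -> u \in S ->
  (forall A, A \subset nbhd E u -> (degsum E A)%:R <= d * #|A|%:R) ->
  Zs l S <= (1 + l) / l * (expR w / (1 + w)) *
              \sum_(I : {set T} | (I \subset S) && (u \in I)) hc l I +
    (1 + l) / l * ln (1 + l) * expR (d * ln (1 + l)) / (1 + w) *
              \sum_(I : {set T} | I \subset S) hc l I * #|nbhd E u :&: I|%:R.
Proof.
move=> l0 w0 uS sp; have l0' := ltW l0; set gam := _ * _ / (1 + w).
pose A := nbhd E u :&: S.
have AS : A \subset S by apply: subsetIr.
have := @hc_cond_ge0 l A (fun I => (I \subset S)%:R)
  (fun I => expR w / (1 + w) * (I :&: A == set0)%:R + gam * #|I :&: A|%:R - 1) l0'.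
(* With no neighbour occupied, [u] is occupied with probability l/(1+l); the factor (1+l)/l turns
   the event that [u] is in [I] into the event that [I] avoids [A]. *)
have -> : (1 + l) / l * (expR w / (1 + w)) *
      \sum_(I : {set T} | (I \subset S) && (u \in I)) hc l I =
    expR w / (1 + w) * \sum_(I : {set T} | I \subset S) hc l I * (I :&: A == set0)%:R.
  have -> : \sum_(I : {set T} | I \subset S) hc l I * (I :&: A == set0)%:R = Zs l (S :\: nbhd E u).
    rewrite /Zs big_mkcond [RHS]big_mkcond; apply: eq_bigr => I _; rewrite subsetD /A setIA.
    case: ifP => //= IS; have -> : (I :&: nbhd E u :&: S == set0) = [disjoint I & nbhd E u].
      by rewrite setIAC (setIidPl IS) setI_eq0.
    by case: ifP; rewrite (mulr0, mulr1).
  rewrite sum_hc_mem // (Zs_nbhd l uS).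
  field; rewrite !gt_eqF ?ltr_wpDr //.
have -> : \sum_(I : {set T} | I \subset S) hc l I * #|nbhd E u :&: I|%:R =
    \sum_(I : {set T} | I \subset S) hc l I * #|I :&: A|%:R.
  by apply: eq_bigr => I IS; rewrite /A setICA (setIidPl IS).
move=> h; rewrite !mulr_sumr -big_split /= /Zs -subr_ge0 -sumrB big_mkcond.
have -> : \sum_(I : {set T}) (if I \subset S then expR w / (1 + w) * (hc l I * (I :&: A == set0)%:R) +
      gam * (hc l I * #|I :&: A|%:R) - hc l I else 0) =
    \sum_I hc l I * ((I \subset S)%:R *
      (expR w / (1 + w) * (I :&: A == set0)%:R + gam * #|I :&: A|%:R - 1)).
  by apply: eq_bigr => I _; case: ifP => _; rewrite /=; ring.
apply: h => // [J JA _|J K JA KA]; last by rewrite subUset (subset_trans KA AS) andbT.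
have FA := avail_sub J A.
(* Given [J], the random part lives on [avail J A], a subset of the neighbourhood of [u] and
   therefore sparse. *)
have := local_occupancy l0 w0 (sp _ (subset_trans FA (subsetIl _ _))); rewrite -/gam.
have JAK K : K \subset avail J A -> (J :|: K) :&: A = K.
  move=> /subset_trans/(_ FA) KA; rewrite setIUl (setIidPl KA).
  suff -> : J :&: A = set0 by rewrite set0U.
  by apply/eqP; rewrite setI_eq0 -[A]setCK -subsets_disjoint.
under eq_bigr => K KF do rewrite JAK //.
rewrite -subr_ge0 => /le_trans; apply; rewrite le_eqVlt; apply/orP; left; apply/eqP.
under eq_bigr => K _ do rewrite mulrDr mulrN1 mulrDr mulrCA [X in _ + X - _]mulrCA.
rewrite sumrB big_split /= -!mulr_sumr -/(Ms l _) -/(Zs l _); congr (_ + _ - _).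
rewrite (bigD1 set0) ?sub0set //= eqxx /hc indep0 cards0 !mul1r big1 ?addr0 ?mulr1 //.
by move=> K /andP[_ /negPf ->]; rewrite mulr0.
Qed.

(* Jensen: [Zs (mu e^r) / Zs mu] is the mean of [e^(r |I|)] at fugacity [mu]. *)
Lemma Zs_ratio mu r A : 0 < mu ->
  Zs mu A * expR (r * (Ms mu A / Zs mu A)) <= Zs (mu * expR r) A.
Proof.
move=> mu0; have Z0 := Zs_gt0 A (ltW mu0); set m := Ms mu A / Zs mu A.
have -> : Zs mu A * expR (r * m) =
   \sum_(I : {set T} | I \subset A) hc mu I * (expR (r * m) * (1 + (r * #|I|%:R - r * m))).
  have -> : \sum_(I : {set T} | I \subset A) hc mu I * (expR (r * m) * (1 + (r * #|I|%:R - r * m))) =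
    \sum_(I : {set T} | I \subset A) (expR (r * m) * (1 - r * m) * hc mu I + expR (r * m) * r * (hc mu I * #|I|%:R)).
    by apply: eq_bigr => I _; ring.
  rewrite big_split /= -!mulr_sumr -/(Zs _ _) -/(Ms _ _) /m; field; rewrite gt_eqF //.
apply: ler_sum => I _; rewrite /hc exprMn -expRM_natl [leRHS]mulrA.
apply: ler_wpM2l; first by rewrite mulr_ge0 ?exprn_ge0 // ltW.
apply: (@le_trans _ _ (expR (r * m) * expR (r * #|I|%:R - r * m))).
  by rewrite ler_wpM2l ?expR_ge0 // expR_ge1Dx.
by rewrite -expRD addrC subrK mulrC.
Qed.

End HardCore.

(** * The occupancy fraction *)

Section LambertW.
Variable R : realType.
Import numFieldNormedType.Exports.

(** From [z = w * expR w] the ratio W(z)/z becomes [expR (- w)], the form in which the occupancy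
    bound produces it. The value picked by [xget] is nonnegative because [w * expR w] has the sign
    of [w]. *)
Lemma W_ratioE (z : R) : 0 <= z ->
  exists w : R, [/\ 0 <= w, w * expR w = z & W_ratio z = expR (- w)].
Proof.
rewrite /W_ratio; have [-> _|z0 zge0] := eqVneq z 0; first by exists 0; rewrite mul0r oppr0 expR0.
have [w _ wz] : exists2 c, c \in `[0, z] & c * expR c = z.
  apply: (@IVT _ (fun c => c * expR c) 0 z z zge0).
    apply: continuous_subspaceT => x; apply: cvgM; [exact: cvg_id|exact: continuous_expR].
  rewrite mul0r ge_min zge0 /= le_max; apply/orP; right.
  by rewrite ler_peMr // -expR0 ler_expR.
have /xgetPex : exists v : R, [set v : R | -1 <= v /\ v * expR v = z]%classic v.
  exists w; split=> //; rewrite leNgt; apply/negP => w1; move: zge0.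
  by rewrite -wz leNgt pmulr_llt0 ?expR_gt0 // (lt_trans w1) // ltrN10.
move=> /(_ 0); rewrite -/(lambertW z) /=; set v := lambertW z => -[_ vz].
have v0 : 0 <= v.
  by move: zge0; rewrite -vz pmulr_lge0 ?expR_gt0.
exists v; split=> //; rewrite -vz expRN invfM mulrA divff ?mul1r //.
by apply: contraNneq z0 => v00; rewrite -vz v00 mul0r.
Qed.

End LambertW.

Section Occupancy.
Import boot.fintype boot.finset.
Variables (R : realType) (V : finType) (G : rel V).

Lemma indep_polyE (x : R) : (indep_poly R G).[x] = Zs G x setT.
Proof.
rewrite /indep_poly horner_sum /Zs big_mkcond [RHS]big_mkcond; apply: eq_bigr => I _.
by rewrite subsetT /hc; case: ifP => _; rewrite ?mul0r // hornerXn mul1r.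
Qed.

Lemma indep_poly_derivE (x : R) : x * ((indep_poly R G)^`()).[x] = Ms G x setT.
Proof.
rewrite /indep_poly raddf_sum horner_sum mulr_sumr /Ms big_mkcond [RHS]big_mkcond.
apply: eq_bigr => I _; rewrite subsetT /hc; case: ifP => _; last by rewrite !mul0r.
rewrite [in LHS]/= derivXn hornerMn hornerXn mul1r -[_ *+ #|I|]mulr_natr mulrA.
by case: #|I| => [|n]; rewrite ?mulr0 // exprS.
Qed.

(* Symmetrized, the difference is a sum of terms (|J| - |I|)(x^|I| y^|J| - x^|J| y^|I|). *)
Lemma occupancy_mono (x y : R) (A : {set V}) : 0 < x -> x <= y ->
  Ms G x A / Zs G x A <= Ms G y A / Zs G y A.
Proof.
move=> x0 xy; have y0 := lt_le_trans x0 xy.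
have Zx := Zs_gt0 G A (ltW x0); have Zy := Zs_gt0 G A (ltW y0).
rewrite ler_pdivrMr // [leRHS]mulrAC ler_pdivlMr // -subr_ge0.
have pairE (a b c d : {set V} -> R) :
   (\sum_(I : {set V} | I \subset A) a I * c I) * (\sum_(I : {set V} | I \subset A) b I * d I) =
   \sum_(I : {set V} | I \subset A) \sum_(J : {set V} | J \subset A) a I * b J * (c I * d J).
  rewrite mulr_suml; apply: eq_bigr => I _; rewrite mulr_sumr; apply: eq_bigr => J _; ring.
have Z1 z : Zs G z A = \sum_(I : {set V} | I \subset A) hc G z I * 1.
  by apply: eq_bigr => I _; rewrite mulr1.
rewrite -(pmulr_rge0 _ (ltr0Sn R 1)) mulr_natl mulr2n.
have e1 : Ms G y A * Zs G x A - Ms G x A * Zs G y A =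
  \sum_(I : {set V} | I \subset A) \sum_(J : {set V} | J \subset A)
     hc G x I * hc G y J * (#|J|%:R - #|I|%:R).
  rewrite [X in X - _]mulrC !Z1 /Ms !pairE -sumrB; apply: eq_bigr => I _.
  by rewrite -sumrB; apply: eq_bigr => J _; ring.
rewrite {1}e1 exchange_big e1 -big_split; apply: sumr_ge0 => I _.
rewrite -big_split; apply: sumr_ge0 => J _ /=.
have -> : hc G x J * hc G y I * (#|I|%:R - #|J|%:R) + hc G x I * hc G y J * (#|J|%:R - #|I|%:R) =
  (indep G I)%:R * (indep G J)%:R * ((#|J|%:R - #|I|%:R) * (x ^+ #|I| * y ^+ #|J| - x ^+ #|J| * y ^+ #|I|)).
  by rewrite /hc; ring.
apply: mulr_ge0; first by rewrite mulr_ge0.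
have key (a b : nat) : (a <= b)%N -> 0 <= x ^+ a * y ^+ b - x ^+ b * y ^+ a.
  move=> ab; rewrite -(subnKC ab) !exprD.
  rewrite subr_ge0 [x ^+ a * _ * _]mulrAC [leRHS]mulrA.
  have [x0' y0'] := (ltW x0, ltW y0).
  by rewrite ler_wpM2l ?mulr_ge0 ?exprn_ge0 // lerXn2r ?nnegrE.
have [ab|ba] := leqP #|I| #|J|.
  by rewrite mulr_ge0 ?key // subr_ge0 ler_nat.
by rewrite -mulrNN !opprB mulr_ge0 ?key ?(ltnW ba) // subr_ge0 ler_nat ltnW.
Qed.

Lemma sum_hc_nbhd (l : R) : simple_graph G -> 0 <= l ->
  \sum_(u : V) \sum_(I : {set V} | I \subset setT) hc G l I * #|nbhd G u :&: I|%:R <=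
  (maxdeg G)%:R * Ms G l setT.
Proof.
move=> [Gsym _] l0; rewrite exchange_big /= mulr_sumr; apply: ler_sum => I _.
rewrite -mulr_sumr mulrCA ler_wpM2l ?hc_ge0 // -natr_sum -natrM ler_nat.
have -> : (\sum_(u : V) #|nbhd G u :&: I| = \sum_(v in I) deg G v)%N.
  transitivity (\sum_(u : V) \sum_(v in I) G u v)%N.
    apply: eq_bigr => u _; rewrite -sum1_card big_mkcond [RHS]big_mkcond.
    by apply: eq_bigr => v _; rewrite !inE; case: (G u v); case: (v \in I).
  rewrite exchange_big; apply: eq_bigr => v _; rewrite /deg -sum1_card [RHS]big_mkcond.
  by apply: eq_bigr => u _; rewrite inE Gsym; case: (G v u).
rewrite mulnC -sum_nat_const; apply: leq_sum => v _.
exact: (@leq_bigmax _ (fun u => deg G u)).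
Qed.

(** Summed over [u], the two coefficients combine to a multiple of (e^w + c)/(1 + w), where c is the
    right-hand side of the equation for [w]. That equation says exactly that the derivative in [w]
    vanishes, and the minimum is e^w. *)
Lemma occupancy_lower (k : nat) (t x w : R) :
  simple_graph G -> (3 <= k)%N -> local_path_bound G k t ->
  0 < x -> 0 <= w ->
  w * expR w = (maxdeg G)%:R * expR ((k%:R - 3 + Num.sqrt (2 * t)) * ln (1 + x)) * ln (1 + x) ->
  x / (1 + x) * expR (- w) * #|V|%:R * Zs G x setT <= Ms G x setT.
Proof.
move=> sG k3 lp x0 w0 wE; have [Gsym Girr] := sG; set d := (_ - 3 + _) in wE *.
have x0' := ltW x0; have p1 : 0 < 1 + x by rewrite ltr_wpDr.
have p2 : 0 < 1 + w by rewrite ltr_wpDr.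
pose gam := (1 + x) / x * ln (1 + x) * expR (d * ln (1 + x)) / (1 + w).
have V1 u : Zs G x setT <= (1 + x) / x * (expR w / (1 + w)) *
      \sum_(I : {set V} | (I \subset setT) && (u \in I)) hc G x I +
    gam * \sum_(I : {set V} | I \subset setT) hc G x I * #|nbhd G u :&: I|%:R.
  by apply: vertex_occupancy => // A; apply: local_path_bound_degsum.
have := ler_sum (index_enum V) (P := predT) (fun u _ => V1 u).
rewrite sumr_const cardT /= -cardE big_split /= -!mulr_sumr -[_ *+ #|V|]mulr_natl.
have -> : \sum_(u : V) \sum_(I : {set V} | (I \subset setT) && (u \in I)) hc G x I = Ms G x setT.
  rewrite /Ms (exchange_big_dep (fun I : {set V} => I \subset setT)) /=; last by [].
  apply: eq_bigr => I _; rewrite (eq_bigl (fun u => u \in I)) ?sumr_const ?mulr_natr // => u.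
  by rewrite subsetT.
move=> h.
have gam0 : 0 <= gam by rewrite !mulr_ge0 ?expR_ge0 ?invr_ge0 ?ln_ge0 ?(ltW p1) ?(ltW p2) // lerDl.
have := ler_wpM2l gam0 (sum_hc_nbhd sG x0') => h2.
have {h h2} h3 : #|V|%:R * Zs G x setT <= (1 + x) / x * expR w * Ms G x setT.
  apply: le_trans h (le_trans (lerD (lexx _) h2) _).
  rewrite [gam * (_ * _)]mulrA -mulrDl ler_wpM2r //; first by apply: sumr_ge0 => I _; rewrite mulr_ge0 ?hc_ge0.
  rewrite le_eqVlt; apply/orP; left; apply/eqP.
  have -> : gam * (maxdeg G)%:R = (1 + x) / x * (w * expR w) / (1 + w) by rewrite wE /gam; ring.
  by field; rewrite !gt_eqF.
rewrite -[_ * #|V|%:R * _]mulrA; apply: le_trans (ler_wpM2l _ h3) _.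
  by have p1' := ltW p1; rewrite !mulr_ge0 ?expR_ge0 ?invr_ge0.
rewrite expRN le_eqVlt; apply/orP; left; apply/eqP; field.
by rewrite !gt_eqF ?expR_gt0.
Qed.

Lemma occupancy_sup (k : nat) (t lam : R) :
  simple_graph G -> (3 <= k)%N -> local_path_bound G k t -> (0 < #|V|)%N -> 0 < lam ->
  sup [set y : R | exists x : R, 0 < x <= lam /\
     y = x / (1 + x) * W_ratio ((maxdeg G)%:R * (1 + x) `^ (k%:R - 3 + Num.sqrt (2 * t)) * ln (1 + x))]%classic
  <= (#|V|%:R)^-1 * (lam * ((indep_poly R G)^`()).[lam] / (indep_poly R G).[lam]).
Proof.
move=> sG k3 lp V0 lam0; rewrite indep_polyE indep_poly_derivE; apply: ge_sup.
  by exists (lam / (1 + lam) * W_ratio ((maxdeg G)%:R * (1 + lam) `^ (k%:R - 3 + Num.sqrt (2 * t)) * ln (1 + lam))), lam; rewrite lam0 lexx.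
move=> y [x [/andP[x0 xl] ->]].
have L0 : 0 <= ln (1 + x) by rewrite ln_ge0 // lerDl ltW.
have x1 : 1 + x != 0 by rewrite gt_eqF // ltr_wpDr // ltW.
have [] := @W_ratioE R ((maxdeg G)%:R * (1 + x) `^ (k%:R - 3 + Num.sqrt (2 * t)) * ln (1 + x)).
  by rewrite !mulr_ge0 ?powR_ge0.
move=> w [w0 wE ->]; move: wE; rewrite /powR (negPf x1) => wE.
have := occupancy_lower sG k3 lp x0 w0 wE => h.
(* The occupancy fraction increases with the fugacity, so a bound at [x] passes to [lam]. *)
apply: (@le_trans _ _ (#|V|%:R^-1 * (Ms G x setT / Zs G x setT))); last first.
  by rewrite ler_wpM2l ?invr_ge0 // occupancy_mono.
rewrite ler_pdivlMl ?ltr0n // ler_pdivlMr ?(Zs_gt0 _ _ (ltW x0)) //.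
by rewrite [#|V|%:R * _]mulrC.
Qed.

End Occupancy.

(** * Fractional colouring *)

Section Schedule.
Import boot.fintype boot.finset.
Variables (R : realType) (V : finType) (G : rel V).
Implicit Types (s : seq (R * {set V})) (T : R) (I S : {set V}).

Definition total s : R := \sum_(p <- s) p.1.
Definition amount s (v : V) : R := \sum_(p <- s | v \in p.2) p.1.

(** The pairs (duration, set) of [s] run one after another from time [T]; [B v] is the deadline by
    which every set containing [v] must have finished. *)
Fixpoint timely (B : V -> R) T s : Prop :=
  if s is p :: s' then (forall v, v \in p.2 -> T + p.1 <= B v) /\ timely B (T + p.1) s'
  else True.

Lemma timely_cat B T s s' :
  timely B T s -> timely B (T + total s) s' -> timely B T (s ++ s').
Proof.
elim: s T => [|p s IH] T /=; first by rewrite /total big_nil addr0.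
by move=> [h1 h2]; rewrite /total big_cons addrA => h3; split=> //; apply: IH.
Qed.

Lemma timely_block B T s : (forall p, p \in s -> 0 <= p.1) ->
  (forall p v, p \in s -> v \in p.2 -> T + total s <= B v) -> timely B T s.
Proof.
elim: s T => //= p s IH T h0 h1; split=> [v vp|].
  apply: le_trans (h1 p v (mem_head _ _) vp); rewrite lerD2l /total big_cons lerDl.
  by rewrite big_seq sumr_ge0 // => q qs; rewrite h0 // inE qs orbT.
apply: IH => [q qs|q v qs vq]; first by rewrite h0 // inE qs orbT.
by rewrite -addrA; have := h1 q v; rewrite /total big_cons inE qs orbT; apply.
Qed.

Variables (bet gam : V -> R) (P : {set V} -> {set V} -> R).
Hypotheses (bet0 : forall v, 0 <= bet v) (gam0 : forall v, 0 <= gam v).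
Hypotheses (P0 : forall S I, 0 <= P S I)
  (Pind : forall S I, P S I != 0 -> indep G I && (I \subset S))
  (Psum : forall S, \sum_I P S I = 1)
  (Pocc : forall S u, u \in S -> 1 <= bet u * \sum_(I : {set V} | u \in I) P S I +
      gam u * \sum_I P S I * #|nbhd G u :&: I|%:R).

Let B v := bet v + gam v * (deg G v)%:R.

(* Run the distribution [P S] on the set [S] of unsaturated vertices, until one of them
   is saturated. *)
Lemma greedy_schedule n S (c : V -> R) T : (#|S| <= n)%N ->
  (forall v, v \in S -> 0 <= c v < 1) -> (forall v, v \notin S -> c v = 1) ->
  (forall u, u \in S -> T <= bet u * c u + gam u * \sum_(v in nbhd G u) c v) ->
  exists s, [/\ forall p, p \in s -> 0 <= p.1 /\ indep G p.2,
    forall v, c v + amount s v = 1 & timely B T s].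
Proof.
elim: n S c T => [|n IH] S c T Sn cS cNS TS.
  have S0 : S = set0 by apply/eqP; rewrite -cards_eq0 -leqn0.
  by exists [::]; split=> // v; rewrite /amount big_nil addr0 cNS // S0 inE.
have [S0|[u0 u0S]] := set_0Vmem S.
  by exists [::]; split=> // v; rewrite /amount big_nil addr0 cNS // S0 inE.
pose p v := \sum_(I : {set V} | v \in I) P S I.
have p0 v : 0 <= p v by apply: sumr_ge0.
have pNS v : v \notin S -> p v = 0.
  move=> vS; apply: big1 => I vI; apply/eqP; apply: contraNT vS => /Pind/andP[_ /subsetP]; exact.
have nbE u : \sum_I P S I * #|nbhd G u :&: I|%:R = \sum_(v in nbhd G u) p v.
  under eq_bigr => I _ do rewrite -sum1_card natr_sum mulr_sumr.
  rewrite (exchange_big_dep (fun v => v \in nbhd G u)) /=; last first.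
    by move=> I v _ /setIP[].
  apply: eq_bigr => v vu; apply: eq_big => I; first by rewrite in_setI vu.
  by rewrite mulr1.
(* Were all [p v] zero, [Pocc] at [u0] would read 1 <= 0. *)
have [v0 /andP[v0S pv0]] : exists v, (v \in S) && (0 < p v).
  apply/existsP; apply: contraT; rewrite negb_exists => /forallP pS.
  have pz v : p v = 0.
    have [vS|/pNS //] := boolP (v \in S).
    by apply/eqP; rewrite eq_le p0 andbT leNgt; have := pS v; rewrite vS.
  by have := Pocc u0S; rewrite nbE -/(p u0) pz big1 // !mulr0 addr0 ler10.
have [v1 /andP[v1S pv1] v1min] :=
  @arg_minP _ R V v0 (fun v => (v \in S) && (0 < p v)) (fun v => (1 - c v) / p v)
    (introT andP (conj v0S pv0)).
(* The first time at which a vertex, namely [v1], is saturated; [S] then shrinks. Meanwhile [Pocc],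
   scaled by [tau], preserves the bound on the elapsed time. *)
set tau := (1 - c v1) / p v1 in v1min.
have tau0 : 0 <= tau.
  by rewrite divr_ge0 // subr_ge0; case/andP: (cS _ v1S) => _ /ltW.
pose c' v := c v + tau * p v.
have c'1 v : c' v <= 1.
  rewrite /c'; have [vS|vS] := boolP (v \in S); last by rewrite pNS // mulr0 addr0 cNS.
  have [pv|] := ltP 0 (p v).
    by rewrite -lerBrDl -ler_pdivlMr // v1min // vS pv.
  rewrite le_eqVlt ltNge p0 orbF => /eqP ->; rewrite mulr0 addr0 ltW //.
  by case/andP: (cS _ vS).
have c'0 v : 0 <= c' v.
  apply: addr_ge0; last by rewrite mulr_ge0.
  by have [/cS/andP[]//|/cNS ->] := boolP (v \in S).
have TS' u : u \in S -> T + tau <= bet u * c' u + gam u * \sum_(v in nbhd G u) c' v.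
  move=> uS; have := TS u uS; have := ler_wpM2l tau0 (Pocc uS).
  rewrite mulr1 nbE -/(p u) /c' big_split -mulr_sumr /=.
  set X := \sum_(i in _) _; set Y := \sum_(i in _) _; move=> h1 h2.
  have -> : bet u * (c u + tau * p u) + gam u * (Y + tau * X) =
    bet u * c u + gam u * Y + tau * (bet u * p u + gam u * X) by ring.
  exact: lerD.
pose S' := [set v in S | c' v < 1].
have [|||u|s [h1 h2 h3]] := IH S' c' (T + tau).
- have : (#|S'| < #|S|)%N.
    apply: proper_card; apply/properP; split; first by apply/subsetP => v; rewrite inE => /andP[].
    exists v1 => //; rewrite inE v1S /= -leNgt /c' /tau divfK ?gt_eqF //.
    by rewrite addrC subrK.
  by move=> /leq_trans/(_ Sn).
- by move=> v; rewrite inE c'0 => /andP[].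
- move=> v; rewrite inE negb_and -leNgt => /orP[vS|]; last by move=> ?; apply: le_anti; rewrite c'1.
  by rewrite /c' pNS // mulr0 addr0 cNS.
- by rewrite inE => /andP[/TS'].
(* Sets of weight zero are dropped, so that every set scheduled is independent and inside [S]. *)
pose blk := [seq (tau * P S J, J) | J <- enum {set V} & P S J != 0].
have blkP q : q \in blk -> exists2 I, q = (tau * P S I, I) & P S I != 0.
  by move=> /mapP[I]; rewrite mem_filter => /andP[PI _] ->; exists I.
have blk_sum (Q : pred {set V}) : \sum_(q <- blk | Q q.2) q.1 = tau * \sum_(I | Q I) P S I.
  rewrite big_map big_filter_cond big_enum_cond mulr_sumr /= [RHS]big_mkcond [LHS]big_mkcond.
  apply: eq_bigr => I _; case: eqP => [->|] //=.
  by rewrite mulr0 if_same.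
have blkT : total blk = tau.
  by rewrite /total (blk_sum predT) Psum mulr1.
exists (blk ++ s); split.
- move=> q; rewrite mem_cat => /orP[/blkP[I -> PI]|/h1 //] /=.
  by rewrite mulr_ge0 //; have /andP[] := Pind PI.
- by move=> v; rewrite /amount big_cat /= (blk_sum (fun I => v \in I)) addrA h2.
apply: timely_cat; last by rewrite blkT.
apply: timely_block => [q /blkP[I -> _] /=|q v /blkP[I -> PI] /= vI]; first by rewrite mulr_ge0.
have /andP[_ /subsetP/(_ v vI) vS] := Pind PI.
(* As no [c'] exceeds 1, the bound on the elapsed time is at most the deadline of [v]. *)
rewrite blkT; apply: le_trans (TS' v vS) _; rewrite lerD // ?ler_piMr //.
rewrite ler_wpM2l // /deg -sum1_card natr_sum; exact: ler_sum.
Qed.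

End Schedule.

(** * Laying out a schedule as intervals of the half-line *)

Section Layout.
Variables (R : realType) (V : finType) (G : rel V) (B : V -> R).
Local Open Scope classical_set_scope.

Lemma schedule_layout (s : seq (R * {set V})) (T : R) :
  (forall p, p \in s -> 0 <= p.1) -> timely B T s ->
  exists w : {set V} -> set R,
  [/\ forall I, measurable (w I), forall I x, w I x -> T <= x,
      forall I J, I != J -> w I `&` w J = set0,
      forall I, @lebesgue_measure R (w I) = (\sum_(p <- s | p.2 == I) p.1)%:E
    & forall I x, w I x -> (exists2 p, p \in s & p.2 = I) /\ forall v, v \in I -> x < B v].
Proof.
elim: s T => [|p s IH] T s0 /=.
  by exists (fun _ => set0); split=> // [I J _|I]; rewrite ?setI0 // measure0 big_nil.
move=> [h1 /IH [q qs|w [w1 w2 w3 w4 w5]]]; first by rewrite s0 // inE qs orbT.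
have p0 : 0 <= p.1 by rewrite s0 // mem_head.
pose J0 : set R := `[T, T + p.1[.
have J0E x : J0 x -> T <= x < T + p.1 by rewrite /J0 /= in_itv.
have muJ0 : @lebesgue_measure R J0 = p.1%:E.
  rewrite lebesgue_measure_itv /= lte_fin ltrDl.
  have [_|p1] := ltP 0 p.1; first by rewrite -EFinB addrC addKr.
  by congr EFin; apply: le_anti; rewrite p0 p1.
have disj I : J0 `&` w I = set0.
  apply/seteqP; split=> // x [/J0E/andP[_ xT] /w2].
  by rewrite leNgt xT.
exists (fun I => if I == p.2 then J0 `|` w I else w I); split.
- by move=> I; case: ifP => // _; apply: measurableU => //; exact: measurable_itv.
- move=> I x; case: ifP => _; last by move/w2; apply: le_trans; rewrite lerDl.
  by case=> [/J0E/andP[]//|/w2]; apply: le_trans; rewrite lerDl.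
- move=> I J IJ; case: ifP => [/eqP eI|_]; case: ifP => [/eqP eJ|_]; last exact: w3.
  + by rewrite eI eJ eqxx in IJ.
  + by rewrite setIUl disj w3 // setU0.
  + by rewrite setIUr w3 // setIC disj setU0.
- move=> I; rewrite big_cons [in RHS]eq_sym; case: ifP => _; last exact: w4.
  have mJ0 : measurable J0 by exact: measurable_itv.
  have -> := measureU (@lebesgue_measure R) mJ0 (w1 I) (disj I).
  by rewrite EFinD; congr (_ + _)%E; [exact: muJ0|exact: w4].
- move=> I x; case: ifP => [/eqP ->|_]; last first.
    by move=> /w5[[q qs qI] h]; split=> //; exists q => //; rewrite inE qs orbT.
  case=> [/J0E/andP[_ xT]|].
    split; first by exists p; rewrite ?mem_head.
    by move=> v vp; apply: lt_le_trans xT (h1 v vp).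
  by move=> /w5[[q qs qI] h]; split=> //; exists q => //; rewrite inE qs orbT.
Qed.

Lemma schedule_colouring (s : seq (R * {set V})) :
  (forall p, p \in s -> 0 <= p.1 /\ indep G p.2) -> (forall v, amount s v = 1) ->
  timely B 0 s ->
  exists w : {set V} -> set R, [/\ frac_colouring G w, w finset.set0 = set0
    & forall (I : {set V}) v, v \in I -> w I `<=` [set x | 0 <= x < B v]].
Proof.
move=> s0 sv sT.
have [p /s0[]//|w [w1 w2 w3 w4 w5]] := schedule_layout _ sT.
(* The empty set contains no vertex and so has no deadline. Its share is discarded, which confines
   all of [w] to a bounded interval when [chi_f] is estimated. *)
exists (fun I => if I == finset.set0 then set0 else w I); split; last 1 first.
- move=> I v vI x; case: ifP => _ // wx; rewrite /= (w2 _ _ wx) /=.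
  by have [_] := w5 _ _ wx; apply.
- split.
  + by move=> I; case: ifP.
  + by move=> I x; case: ifP => _; [|exact: w2].
  + move=> I nI; case: ifP => // _; apply/seteqP; split=> // x /w5[[p /s0[_ ip] pI] _].
    by rewrite -pI ip in nI.
  + by move=> I J IJ; case: ifP; case: ifP => _ _; rewrite ?set0I ?setI0 //; exact: w3.
  + move=> v; under eq_bigr => I /andP[_ vI].
      rewrite ifF; last by apply: contraTF vI => /eqP ->; rewrite finset.inE.
      rewrite w4; over.
    rewrite sumEFin; congr EFin; rewrite -(sv v) /amount.
    rewrite (exchange_big_dep (fun p : R * {set V} => v \in p.2)) /=; last first.
      by move=> I p /andP[_ vI] /eqP ->.
    rewrite big_seq_cond [RHS]big_seq_cond; apply: eq_bigr => p /andP[ps vp].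
    rewrite (big_pred1 p.2) // => I /=; rewrite eq_sym.
    by case: eqP => [->|]; rewrite ?andbF // vp (s0 p ps).2.
- by rewrite eqxx.
Qed.

End Layout.

Section FractionalColouring.
Import boot.fintype boot.finset.
Variable R : realType.

Lemma sqrtD_bound (k : nat) (t : R) : (3 <= k)%N -> 1 / 2 <= t ->
  0 <= k%:R - 3 + Num.sqrt (2 * t) /\
  k%:R - 3 + Num.sqrt (2 * t) + 1 <= 2 * (k%:R + Num.sqrt t) /\
  3 <= k%:R + Num.sqrt t.
Proof.
move=> k3 t2; have k3' : 3 <= k%:R :> R by rewrite ler_nat.
have t0 : 0 <= t by apply: le_trans t2; rewrite divr_ge0.
have s0 := sqrtr_ge0 t; have s0' := sqrtr_ge0 (2 * t).
have s2 : Num.sqrt (2 * t) <= 2 * Num.sqrt t.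
  have := @ler_wsqrtr R 2 (2 ^+ 2); rewrite sqrtr_sqr ger0_norm // => h.
  by rewrite sqrtrM // ler_wpM2r // h //; lra.
by split; [lra|split; lra].
Qed.

Lemma expRN_le (x : R) : 0 < x -> expR (- x) <= x^-1.
Proof.
move=> x0; rewrite expRN lef_pV2 ?posrE ?expR_gt0 //.
by apply: le_trans (expR_ge1Dx x); rewrite lerDr.
Qed.

(* With [q = D / K], the choice [w = (1 - eta) ln q] makes the first term, of order
   [K q^(1 - eta) / w], negligible against the second, of order [K q / w]. *)
Lemma frac_budget_bound (eta K d D l w : R) : 0 < eta -> eta <= 1 / 20 ->
  1 <= K -> 0 <= d -> d <= 2 * K -> 0 < D -> eta ^- 3 <= ln (D / K) ->
  l = eta / K -> w = (1 - eta) * ln (D / K) ->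
  (1 + l) / l * (expR w / (1 + w)) +
  (1 + l) / l * ln (1 + l) * expR (d * ln (1 + l)) / (1 + w) * D <=
  (1 + 20 * eta) * (D / ln (D / K)).
Proof.
move=> e0 e1 K1 d0 dK D0; set X := ln (D / K) => hX lE wE.
have K0 : 0 < K by lra.
have l0 : 0 < l by rewrite lE divr_gt0.
have le : l <= eta by rewrite lE ler_pdivrMr // ler_peMr // ltW.
have e3 : 0 < eta ^- 3 by rewrite invr_gt0 exprn_gt0.
have X0 : 0 < X by lra.
have w1 : (1 - eta) * X <= 1 + w by rewrite wE; lra.
have p0 : 0 < (1 - eta) * X by rewrite mulr_gt0 //; lra.
have wpos : 0 <= w by rewrite wE ltW.
have w0 : 0 < 1 + w by lra.
have lnl : ln (1 + l) <= l by apply: le_ln1Dx; lra.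
have lnl0 : 0 <= ln (1 + l) by rewrite ln_ge0 // lerDl ltW.
have E1 : expR (d * ln (1 + l)) <= (1 - 2 * eta)^-1.
  apply: (@le_trans _ _ (expR (2 * eta))).
    rewrite ler_expR; apply: (@le_trans _ _ (2 * K * l)); first by apply: ler_pM.
    by rewrite lE -mulrA [K * _]mulrC divfK // gt_eqF.
  rewrite -[leLHS]invrK -expRN lef_pV2 ?posrE ?expR_gt0 //; last lra.
  exact: expR_ge1Dx.
have E2 : expR w <= D / K * eta ^+ 2.
  have -> : w = X + - (eta * X) by rewrite wE; ring.
  rewrite expRD lnK ?posrE ?divr_gt0 // ler_wpM2l ?divr_ge0 ?(ltW D0) ?(ltW K0) //.
  apply: le_trans (expRN_le _) _; first by rewrite mulr_gt0.
  rewrite invf_ple ?posrE ?mulr_gt0 ?exprn_gt0 //.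
  have -> : (eta ^+ 2)^-1 = eta * eta ^- 3 by field; rewrite gt_eqF.
  by rewrite ler_wpM2l // ltW.
have iw : (1 + w)^-1 <= ((1 - eta) * X)^-1 by rewrite lef_pV2 ?posrE.
have iw0 : 0 <= (1 + w)^-1 by rewrite invr_ge0 ltW.
have T1 : (1 + l) / l * (expR w / (1 + w)) <=
    (1 + eta) / l * ((D / K * eta ^+ 2) / ((1 - eta) * X)).
  apply: ler_pM; rewrite ?mulr_ge0 ?expR_ge0 ?invr_ge0 ?ler_wpM2r ?invr_ge0 ?(ltW l0) ?addr_ge0 ?(ltW l0) //.
    by rewrite lerD2l.
  by apply: ler_pM; rewrite ?expR_ge0.
have T2 : (1 + l) / l * ln (1 + l) * expR (d * ln (1 + l)) / (1 + w) * D <=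
    (1 + eta) * (1 - 2 * eta)^-1 / ((1 - eta) * X) * D.
  apply: ler_wpM2r; first exact: ltW.
  apply: ler_pM => //.
    by rewrite !mulr_ge0 ?expR_ge0 ?invr_ge0 ?addr_ge0 ?(ltW l0).
  apply: ler_pM; rewrite ?expR_ge0 //.
    by rewrite !mulr_ge0 ?expR_ge0 ?invr_ge0 ?addr_ge0 ?(ltW l0).
  apply: (@le_trans _ _ ((1 + l) / l * l)).
    by rewrite ler_wpM2l // mulr_ge0 ?invr_ge0 ?addr_ge0 ?(ltW l0).
  by rewrite divfK ?gt_eqF // lerD2l.
apply: le_trans (lerD T1 T2) _.
have -> : (1 + eta) / l * ((D / K * eta ^+ 2) / ((1 - eta) * X)) +
    (1 + eta) * (1 - 2 * eta)^-1 / ((1 - eta) * X) * D =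
  (1 + eta) / (1 - eta) * (eta + (1 - 2 * eta)^-1) * (D / X).
  rewrite lE; field; rewrite !gt_eqF //; lra.
apply: ler_wpM2r; first by rewrite divr_ge0 // ltW.
have -> : (1 + eta) / (1 - eta) * (eta + (1 - 2 * eta)^-1) =
   ((1 + eta) * (eta * (1 - 2 * eta) + 1)) / ((1 - eta) * (1 - 2 * eta)).
  by field; rewrite !gt_eqF //; lra.
rewrite ler_pdivrMr; last by rewrite mulr_gt0 //; lra.
nra.
Qed.

(** An upper bound [D u] replaces the degree so that one statement serves twice: with the maximum of
    deg(u) and the threshold for the local colouring, and with the constant maximum degree for
    [chi_f]. *)
Lemma sparse_frac_colouring (eps : R) : 0 < eps -> exists2 delta0 : R, 1 < delta0 &
  forall (V : finType) (G : rel V) (k : nat) (t : R) (D : V -> R),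
  simple_graph G -> (3 <= k)%N -> 1 / 2 <= t -> local_path_bound G k t ->
  (forall u, (deg G u)%:R <= D u) -> (forall u, delta0 * (k%:R + Num.sqrt t) <= D u) ->
  exists w : {set V} -> set R, [/\ frac_colouring G w, w set0 = classical_sets.set0
    & forall (I : {set V}) v, v \in I -> (w I `<=` [set x | (0 <= x <
        (1 + eps) * (D v / ln (D v / (k%:R + Num.sqrt t))))%R])%classic].
Proof.
move=> eps0; set eta := Num.min eps 1 / 20.
have e0 : 0 < eta by rewrite divr_gt0 // lt_min eps0 ltr01.
have e1 : eta <= 1 / 20 by rewrite ler_wpM2r ?invr_ge0 // ge_min lexx orbT.
have e2 : 20 * eta <= eps.
  by rewrite /eta mulrC divfK ?pnatr_eq0 // ge_min lexx.
have e3 : 0 < eta ^- 3 by rewrite invr_gt0 exprn_gt0.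
(* This forces X = ln(D/K) to be at least [eta ^- 3], and then e^(-eta X) <= 1/(eta X) <= eta^2. *)
exists (expR (eta ^- 3)); first by rewrite -expR0 ltr_expR.
move=> V G k t D sG k3 t2 lp dD KD; have [Gsym Girr] := sG.
have [d0 [dK K3]] := sqrtD_bound k3 t2; set d := (_ - 3 + _) in d0 dK.
set K := k%:R + _ in dK K3 KD *.
have K0 : 0 < K by lra.
have D0 u : 0 < D u by apply: lt_le_trans (KD u); rewrite mulr_gt0 ?expR_gt0.
have lnD u : eta ^- 3 <= ln (D u / K).
  by rewrite -[leLHS]expRK ler_ln ?posrE ?expR_gt0 ?divr_gt0 // ler_pdivlMr.
(* The fugacity is common to all vertices, while the tangent point [wt u] follows the degree bound
   of [u]. *)
set l := eta / K; pose wt u := (1 - eta) * ln (D u / K).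
have l0 : 0 < l by rewrite divr_gt0.
have lnl0 : 0 <= ln (1 + l) by rewrite ln_ge0 // lerDl ltW.
have wt0 u : 0 <= wt u.
  by rewrite mulr_ge0 //; [lra|exact: le_trans (ltW e3) (lnD u)].
pose bet u := (1 + l) / l * (expR (wt u) / (1 + wt u)).
pose gam u := (1 + l) / l * ln (1 + l) * expR (d * ln (1 + l)) / (1 + wt u).
have l1 : 0 <= (1 + l) / l by rewrite divr_ge0 ?addr_ge0 // ltW.
have bet0 u : 0 <= bet u by rewrite mulr_ge0 // divr_ge0 ?expR_ge0 ?addr_ge0.
have gam0 u : 0 <= gam u by rewrite divr_ge0 ?addr_ge0 // mulr_ge0 ?expR_ge0 // mulr_ge0.
pose P (S I : {set V}) := (I \subset S)%:R * hc G l I / Zs G l S.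
have Z0 S : 0 < Zs G l S := Zs_gt0 G S (ltW l0).
have P0 S I : 0 <= P S I by rewrite /P divr_ge0 ?(ltW (Z0 S)) // mulr_ge0 // hc_ge0 // ltW.
have Pind S I : P S I != 0 -> indep G I && (I \subset S).
  by rewrite /P /hc; case: (indep G I); case: (I \subset S); rewrite ?(mul0r, mulr0, eqxx).
have Psum S : \sum_I P S I = 1.
  rewrite -mulr_suml; have -> : \sum_(I : {set V}) (I \subset S)%:R * hc G l I = Zs G l S.
    by rewrite /Zs [RHS]big_mkcond; apply: eq_bigr => I _; case: ifP; rewrite ?(mul1r, mul0r).
  by rewrite divff // gt_eqF.
have Pocc (S : {set V}) u : u \in S -> 1 <= bet u * \sum_(I : {set V} | u \in I) P S I +
      gam u * \sum_(I : {set V}) P S I * #|nbhd G u :&: I|%:R.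
  move=> uS; have := vertex_occupancy Gsym Girr l0 (wt0 u) uS (fun A => local_path_bound_degsum sG k3 lp (A := A)).
  rewrite -/d -/(bet u) -/(gam u) -[X in X <= _]mul1r -ler_pdivlMr // mulrDl => /le_trans; apply.
  rewrite le_eqVlt; apply/orP; left; apply/eqP.
  rewrite -[X in X + _ = _]mulrA -[X in _ + X = _]mulrA; congr (_ * _ + _ * _).
    rewrite mulr_suml big_mkcond [RHS]big_mkcond; apply: eq_bigr => I _; rewrite /P.
    by case: (I \subset S); case: (u \in I); rewrite //= ?mul1r ?mul0r.
  rewrite mulr_suml big_mkcond; apply: eq_bigr => I _; rewrite /P.
  by case: (I \subset S); rewrite ?mul0r // mul1r mulrAC.
have [|||s [s1 s2 s3]] := @greedy_schedule R V G bet gam P bet0 gam0 P0 Pind Psum Pocc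
  #|V| setT (fun _ => 0) 0 (max_card _).
- by move=> v _; rewrite lexx ltr01.
- by move=> v; rewrite in_setT.
- by move=> u _; rewrite big1 // !mulr0 addr0.
have [|w [w1 w2 w3]] := schedule_colouring s1 _ s3.
  by move=> v; have := s2 v; rewrite add0r.
exists w; split=> // I v vI x /(w3 _ _ vI) /= /andP[-> xB] /=.
apply: lt_le_trans xB _.
have lnD0 : 0 < ln (D v / K) := lt_le_trans e3 (lnD v).
apply: (@le_trans _ _ (bet v + gam v * D v)); first by rewrite lerD2l ler_wpM2l.
have dK' : d <= 2 * K by lra.
have K1 : 1 <= K by lra.
apply: le_trans (frac_budget_bound e0 e1 K1 d0 dK' (D0 v) (lnD v) (erefl _) (erefl _)) _.
by rewrite ler_wpM2r ?divr_ge0 ?(ltW (D0 v)) ?(ltW lnD0) // lerD2l.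
Qed.

Lemma local_frac_colouring (eps : R) : 0 < eps -> exists delta0 : R,
  forall (V : finType) (G : rel V) (k : nat) (t : R),
  simple_graph G -> (3 <= k)%N -> 1 / 2 <= t -> local_path_bound G k t ->
  exists w : {set V} -> set R, frac_colouring G w /\
    forall u : V, (colour_of G w u `<=` [set x : R | (0 <= x < (1 + eps) *
      Num.max ((deg G u)%:R / ln ((deg G u)%:R / (k%:R + Num.sqrt t)))
              (delta0 / ln delta0 * (k%:R + Num.sqrt t)))%R])%classic.
Proof.
move=> eps0; have [delta0 d1 core] := sparse_frac_colouring eps0; exists delta0.
move=> V G k t sG k3 t2 lp; have [_ [_ K3]] := sqrtD_bound k3 t2.
have [|u|w [w1 _ w3]] := core V G k t
  (fun u => Num.max (deg G u)%:R (delta0 * (k%:R + Num.sqrt t))) sG k3 t2 lp.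
- by move=> u; rewrite le_max lexx.
- by rewrite le_max lexx orbT.
exists w; split=> // u x [I /= [_ uI] wx]; have /= /andP[-> xB] := w3 _ _ uI _ wx.
apply: lt_le_trans xB _; rewrite ler_wpM2l ?addr_ge0 ?(ltW eps0) //.
rewrite le_max; have [_|_] := leP (delta0 * (k%:R + Num.sqrt t)) (deg G u)%:R.
  by rewrite lexx.
apply/orP; right; rewrite mulfK ?gt_eqF //; last lra.
by rewrite mulrAC.
Qed.

Lemma chi_f_bound (eps : R) : 0 < eps -> exists C : R,
  forall (V : finType) (G : rel V) (k : nat) (t : R),
  simple_graph G -> (3 <= k)%N -> 1 / 2 <= t -> local_path_bound G k t ->
  C <= (maxdeg G)%:R / (k%:R + Num.sqrt t) ->
  chi_f R G <= (1 + eps) * ((maxdeg G)%:R / ln ((maxdeg G)%:R / (k%:R + Num.sqrt t))).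
Proof.
move=> eps0; have [delta0 d1 core] := sparse_frac_colouring eps0; exists delta0.
move=> V G k t sG k3 t2 lp CK; have [_ [_ K3]] := sqrtD_bound k3 t2.
have K0 : 0 < k%:R + Num.sqrt t by lra.
have [|_|w [w1 w2 w3]] := core V G k t (fun u => (maxdeg G)%:R) sG k3 t2 lp.
- by move=> u; rewrite ler_nat; exact: (@leq_bigmax _ (fun u => deg G u)).
- by rewrite -ler_pdivlMr.
apply: inf_lbound; first by exists 0 => x [].
split; first rewrite mulr_ge0 ?divr_ge0 ?addr_ge0 ?(ltW eps0) // ln_ge0 //.
  exact: le_trans (ltW d1) CK.
exists w; split=> // I; have [->|[v vI]] := set_0Vmem I; first by rewrite w2.
exact: w3 vI.
Qed.

End FractionalColouring.

(** * Correspondence colouring *)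

Section HardCoreTail.
Import boot.fintype boot.finset.
Variables (R : realType) (T : finType) (E : rel T).
Hypotheses (Esym : symmetric E) (Eirr : irreflexive E).
Implicit Types (A F I J K X : {set T}) (l kap r d c delta : R).

(** The factor e^(-r|K|) lowers the fugacity to l e^(-r); the empty set alone is weighted by
    e^(-1). *)
Lemma sum_hc_expR l r F :
  \sum_(K : {set T} | K \subset F) hc E l K * expR (- ((K == set0)%:R + r * #|K|%:R)) =
  Zs E (l * expR (- r)) F - 1 + expR (-1).
Proof.
rewrite /Zs (bigD1 set0) ?sub0set //= [in RHS](bigD1 set0) ?sub0set //= eqxx.
have h0 x : hc E x set0 = 1 by rewrite /hc indep0 cards0 mul1r.
rewrite !h0 cards0 mulr0 addr0 mul1r mulr1n.
rewrite [X in _ + X = _](eq_bigr (fun K : {set T} => hc E (l * expR (- r)) K)); first by ring.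
move=> K /andP[_ /negPf ->]; rewrite /hc add0r -mulrA exprMn -expRM_natl.
by rewrite mulrN [r * _]mulrC.
Qed.

(** [l * kap] is the occupancy per vertex that sparsity guarantees at the lowered fugacity. Jensen's
    inequality then bounds the growth of the partition function on the way back up to [l]. *)
Lemma Zs_ratio_sparse l kap r d F : 0 < l -> 0 <= r -> (degsum E F)%:R <= d * #|F|%:R ->
  (let mu := l * expR (- r) in l * kap <= mu / (1 + mu) * expR (- (d * ln (1 + mu)))) ->
  Zs E (l * expR (- r)) F * expR (r * (#|F|%:R * (l * kap))) <= Zs E l F.
Proof.
move=> l0 r0 dF /=; set mu := l * expR (- r) => hkap.
have mu0 : 0 < mu by rewrite mulr_gt0 ?expR_gt0.
have Zmu := Zs_gt0 E F (ltW mu0).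
have lE : l = mu * expR r by rewrite /mu -mulrA -expRD addNr expR0 mulr1.
apply: (@le_trans _ _ (Zs E (mu * expR r) F)); last by rewrite -lE.
apply: le_trans (Zs_ratio E r F mu0); apply: ler_wpM2l; first exact: ltW.
rewrite ler_expR ler_wpM2l // ler_pdivlMr //.
apply: le_trans (Ms_ge Esym Eirr mu0 dF); rewrite ler_wpM2r ?(ltW Zmu) //.
by rewrite [leRHS]mulrCA ler_wpM2l.
Qed.

(* [Y0] is a threshold on [l |F|]: above it the factor [e^(-r |K|)] suffices, below it
   the empty set has probability at least [e^(-Y0)] and its factor [e^(-1)] does. *)
Lemma sum_hc_expR_le l kap r d (Y0 : R) F : 0 < l -> 0 <= r -> 0 <= Y0 -> 0 <= kap <= 1 ->
  r * Y0 <= expR (- Y0) / 2 -> (degsum E F)%:R <= d * #|F|%:R ->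
  (let mu := l * expR (- r) in l * kap <= mu / (1 + mu) * expR (- (d * ln (1 + mu)))) ->
  \sum_(K : {set T} | K \subset F) hc E l K * expR (- ((K == set0)%:R + r * #|K|%:R)) <=
  expR (- (r * (kap * Y0))) * Zs E l F.
Proof.
move=> l0 r0 Y00 /andP[k0 k1] rY dF hk; rewrite sum_hc_expR.
have := Zs_ratio_sparse l0 r0 dF hk.
have e1 : expR (-1) <= 1 / 2 :> R.
  by rewrite expRN mul1r lef_pV2 ?posrE ?expR_gt0 //; have := expR_ge1Dx (1 : R).
have Z0 := Zs_gt0 E F (ltW l0).
have [YF|YF] := leP Y0 (#|F|%:R * l) => h.
  have : Zs E (l * expR (- r)) F <= expR (- (r * (kap * Y0))) * Zs E l F.
    rewrite [expR (- (r * (kap * Y0)))]expRN [leRHS]mulrC ler_pdivlMr ?expR_gt0 //; apply: le_trans h.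
    rewrite ler_wpM2l ?Zs_ge0 ?mulr_ge0 ?expR_ge0 ?(ltW l0) // ler_expR ler_wpM2l //.
    by rewrite mulrA [leRHS]mulrC ler_wpM2l.
  lra.
have Zm : Zs E (l * expR (- r)) F <= Zs E l F.
  apply: le_trans h; rewrite ler_peMr ?Zs_ge0 ?mulr_ge0 ?expR_ge0 ?(ltW l0) //.
  by rewrite -[leLHS]expR0 ler_expR !mulr_ge0 ?(ltW l0).
have ZY : Zs E l F <= expR Y0.
  apply: le_trans (Zs_le Esym Eirr F (ltW l0)) _; rewrite expR_lnX ?(ltW l0) // ler_expR.
  apply: le_trans (ltW YF); rewrite ler_wpM2l //; apply: le_ln1Dx.
  by apply: lt_trans l0; rewrite ltrN10.
have h2 : (1 - r * (kap * Y0)) * Zs E l F <= expR (- (r * (kap * Y0))) * Zs E l F.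
  by rewrite ler_wpM2r ?(ltW Z0) // expR_ge1Dx.
have h3 : r * (kap * Y0) * Zs E l F <= 1 / 2.
  apply: (@le_trans _ _ (expR (- Y0) / 2 * expR Y0)).
    apply: ler_pM => //; rewrite ?(ltW Z0) ?mulr_ge0 //.
    by apply: le_trans rY; rewrite ler_wpM2l // ler_piMl.
  by rewrite mulrAC -expRD addNr expR0.
lra.
Qed.

(** Each [A x] is integrated out in turn: by disjointness the remaining factors and [g] are fixed by
    [I] outside [A x], so every step gains a factor [c]. The weight [g] leaves room for conditioning
    on the absence of distant flaws. *)
Lemma hc_prod_le l c (X : {set T}) (A : T -> {set T}) (f : T -> {set T} -> R)
    (g : {set T} -> R) :
  0 <= l -> 0 <= c ->
  (forall x y, x \in X -> y \in X -> x != y -> [disjoint A x & A y]) ->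
  (forall x K, 0 <= f x K) ->
  (forall x F, x \in X -> F \subset A x ->
     \sum_(K : {set T} | K \subset F) hc E l K * f x K <= c * Zs E l F) ->
  (forall I, 0 <= g I) ->
  (forall x J K, x \in X -> K \subset A x -> g (J :|: K) = g J) ->
  \sum_I hc E l I * (g I * \prod_(x in X) f x (I :&: A x)) <=
  c ^+ #|X| * \sum_I hc E l I * g I.
Proof.
move=> l0 c0; elim: {X}#|X| {-2}X (erefl #|X|) => [|n IH] X en disj f0 fc g0 gA.
  rewrite en mul1r le_eqVlt; apply/orP; left; apply/eqP/eq_bigr => I _.
  by rewrite (cards0_eq en) big_set0 mulr1.
have [x xX] : exists x, x \in X by apply/set0Pn; rewrite -cards_eq0 en.
have en' : #|X :\ x| = n by apply/eqP; rewrite -eqSS -en [eqbRHS](cardsD1 x) xX.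
have sub y : y \in X :\ x -> y \in X by case/setD1P.
rewrite en exprS -mulrA -en'.
apply: le_trans (ler_wpM2l c0 (IH (X :\ x) en' _ f0 _ g0 _)); last first.
- by move=> y J K /sub; apply: gA.
- by move=> y F /sub; apply: fc.
- by move=> y z /sub yX /sub; apply: disj.
rewrite mulr_sumr -subr_ge0 -sumrB.
have -> : \sum_(I : {set T}) (c * (hc E l I * (g I * \prod_(y in X :\ x) f y (I :&: A y))) -
      hc E l I * (g I * \prod_(y in X) f y (I :&: A y))) =
    \sum_I hc E l I * ((g I * \prod_(y in X :\ x) f y (I :&: A y)) * (c - f x (I :&: A x))).
  by apply: eq_bigr => I _; rewrite [in LHS](big_setD1 x xX) /=; ring.
apply: (hc_cond_ge0 Esym l0 (A := A x)).
- move=> J JA _.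
  have FA := avail_sub E J (A x).
  have JA0 : J :&: A x = set0.
    by apply/eqP; rewrite setI_eq0 -[A x]setCK -subsets_disjoint.
  have := fc x _ xX FA; rewrite -subr_ge0 => /le_trans; apply.
  rewrite le_eqVlt; apply/orP; left; apply/eqP.
  rewrite /Zs mulr_sumr -sumrB; apply: eq_bigr => K KF.
  by rewrite setIUl JA0 set0U (setIidPl (subset_trans KF FA)); ring.
- by move=> I; rewrite mulr_ge0 // prodr_ge0.
- move=> J K JA KA; rewrite (gA x) //; congr (_ * _); apply: eq_bigr => y /setD1P[yx yX].
  congr (f y _); rewrite setIUl (_ : K :&: A y = set0) ?setU0 //.
  apply/eqP; rewrite setI_eq0; apply: disjointWl KA _; apply: disj => //.
  by rewrite eq_sym.
Qed.

(** Given [I] outside [A], the available set F is determined, and [I] misses [A] with probability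
    1/Z_F. *)
Lemma hc_avail_le l delta A (g : {set T} -> R) (P : pred {set T}) :
  0 <= l ->
  (forall F, F \subset A -> P F -> 1 <= delta * Zs E l F) -> 0 <= delta ->
  (forall I, 0 <= g I) ->
  (forall J K, K \subset A -> g (J :|: K) = g J) ->
  \sum_I hc E l I * (g I * ((I :&: A == set0) && P (avail E I A))%:R) <=
  delta * \sum_I hc E l I * g I.
Proof.
move=> l0 hP d0 g0 gA; rewrite mulr_sumr -subr_ge0 -sumrB.
have -> : \sum_(I : {set T}) (delta * (hc E l I * g I) -
      hc E l I * (g I * ((I :&: A == set0) && P (avail E I A))%:R)) =
    \sum_I hc E l I * (g I * (delta - ((I :&: A == set0) && P (avail E I A))%:R)).
  by apply: eq_bigr => I _; ring.
apply: (hc_cond_ge0 Esym l0 (A := A)) => // [J JA _|J K _]; last exact: gA.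
have FA := avail_sub E J A.
have JA0 : J :&: A = set0.
  by apply/eqP; rewrite setI_eq0 -[A]setCK -subsets_disjoint.
have -> : \sum_(K : {set T} | K \subset avail E J A) hc E l K *
    (delta - (((J :|: K) :&: A == set0) && P (avail E (J :|: K) A))%:R) =
    delta * Zs E l (avail E J A) - (P (avail E J A))%:R.
  rewrite /Zs mulr_sumr (bigD1 set0) ?sub0set //= [in RHS](bigD1 set0) ?sub0set //=.
  rewrite setU0 JA0 eqxx /= [in RHS]addrAC; congr (_ + _).
    by rewrite /hc indep0 cards0 !mul1r mulr1.
  apply: eq_bigr => K /andP[KF /negPf K0].
  by rewrite setIUl JA0 set0U (setIidPl (subset_trans KF FA)) K0 subr0 mulrC.
rewrite subr_ge0; case PF: (P _); first exact: hP.
by rewrite mulr_ge0 // Zs_ge0.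
Qed.

End HardCoreTail.

(** * The lopsided local lemma *)

Section LocalLemma.
Import boot.fintype boot.finset.
Variables (R : realType) (V Om : finType) (mu : Om -> R) (B : V -> pred Om) (p : R) (N : nat).
Variable Gam : V -> {set V}.
Implicit Types S X Y : {set V}.
Hypotheses (mu0 : forall w, 0 <= mu w) (mupos : 0 < \sum_w mu w) (p0 : 0 <= p).
Hypotheses (N0 : (0 < N)%N) (pN : 4 * p * N%:R <= 1) (GamN : forall u, (#|Gam u| <= N)%N).

Let W S := \sum_(w | [forall v in S, ~~ B v w]) mu w.

(* Lopsided version: [p] bounds the probability of [B u] conditional on the absence
   of any family of flaws outside [Gam u]. *)
Hypothesis cond : forall u S, [disjoint S & Gam u] ->
  \sum_(w | B u w && [forall v in S, ~~ B v w]) mu w <= p * W S.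

(** By induction on [S], adding [u] to the vertices required to be flawless keeps at least the
    proportion 1 - 2p of the measure. *)
Lemma local_lemma : exists2 w, mu w != 0 & forall v, ~~ B v w.
Proof.
have p4 : 4 * p <= 1.
  by apply: le_trans pN; rewrite ler_peMr ?mulr_ge0 // ler1n.
have q0 : 0 <= 1 - 2 * p by lra.
have W_ge0 S : 0 <= W S by apply: sumr_ge0.
have W_mono X Y : X \subset Y -> W Y <= W X.
  move=> XY; rewrite /W big_mkcond [leRHS]big_mkcond; apply: ler_sum => w _.
  case: ifP => [/forall_inP h|_]; last by case: ifP.
  by rewrite ifT //; apply/forall_inP => v vX; apply/h/(subsetP XY).
have bern n : 1 - 2 * p * n%:R <= (1 - 2 * p) ^+ n.
  elim: n => [|n IHn]; first by rewrite mulr0 subr0.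
  rewrite exprS; apply: le_trans (ler_wpM2l q0 IHn); rewrite -natr1.
  have : 0 <= n%:R :> R by []; nra.
have key n : forall S u, (#|S| < n)%N -> (1 - 2 * p) * W S <= W (u |: S).
  elim: n => // n IH S u; rewrite ltnS => Sn.
  have chain m : forall X, X \subset S -> #|S :\: X| = m -> (1 - 2 * p) ^+ m * W X <= W S.
    elim: m => [|m IHm] X XS em.
      rewrite mul1r; suff -> : X = S by [].
      by apply/eqP; rewrite eqEsubset XS -setD_eq0 -cards_eq0 em.
    have [v] : exists v, v \in S :\: X by apply/set0Pn; rewrite -cards_eq0 em.
    move=> /setDP[vS vX]; have vXS : v |: X \subset S by rewrite subUset sub1set vS.
    have ev : #|S :\: (v |: X)| = m.
      apply/eqP; rewrite -eqSS -em (cardsD1 v (S :\: X)) !inE vS vX /= add1n eqSS.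
      by apply/eqP/eq_card => y; rewrite !inE negb_or -andbA.
    rewrite exprSr -mulrA; apply: le_trans (IHm _ vXS ev).
    rewrite ler_wpM2l ?exprn_ge0 // IH //; apply: leq_trans Sn; apply: proper_card.
    by rewrite properE XS; apply/subsetPn; exists v.
  have Wu : W (u |: S) = W S - \sum_(w | B u w && [forall v in S, ~~ B v w]) mu w.
    rewrite /W [\sum_(w | [forall v in S, _]) _](bigID (B u)) /=.
    rewrite [in RHS](eq_bigl (fun w => B u w && [forall v in S, ~~ B v w])); last first.
      by move=> w; rewrite andbC.
    rewrite addrC addrK; apply: eq_bigl => w; apply/forall_inP/andP => [h|[/forall_inP h nu] v].
      by split; [apply/forall_inP => v vS; apply: h; rewrite inE vS orbT|apply: h; rewrite setU11].
    by rewrite inE => /orP[/set1P ->//|]; apply: h.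
  have le1 : \sum_(w | B u w && [forall v in S, ~~ B v w]) mu w <= p * W (S :\: Gam u).
    apply: le_trans (@cond u (S :\: Gam u) _); last first.
      by rewrite disjoints_subset setDE subsetIr.
    rewrite big_mkcond [leRHS]big_mkcond; apply: ler_sum => w _.
    case: ifP => [/andP[-> /forall_inP h]|_]; last by case: ifP.
    by rewrite ifT //; apply/forall_inP => v /setDP[/h].
  (* Putting back the at most [N] vertices of [Gam u] keeps a proportion (1-2p)^N >= 1 - 2pN >= 1/2,
     so the bound [p] outside [Gam u] at most doubles. *)
  have := chain _ (S :\: Gam u) (subsetDl _ _) (erefl _).
  set m := #|_|; have mN : (m <= N)%N.
    apply: leq_trans (GamN u); apply/subset_leq_card/subsetP => y.
    by rewrite !inE negb_and negbK => /andP[/orP[//|/negP]].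
  have hm : 1 / 2 <= (1 - 2 * p) ^+ m.
    apply: le_trans (bern m); have : m%:R <= N%:R :> R by rewrite ler_nat.
    move=> /(ler_wpM2l p0); move: pN; rewrite -!mulrA.
    by move: (p * m%:R) (p * N%:R) => a b; lra.
  move=> /(le_trans (ler_wpM2r (W_ge0 _) hm)) hW; rewrite Wu.
  have := ler_wpM2l p0 hW; lra.
have Wpos n : forall S, (#|S| <= n)%N -> 0 < W S.
  elim: n => [|n IHn] S Sn.
    have -> : S = set0 by apply/eqP; rewrite -cards_eq0 -leqn0.
    rewrite /W (eq_bigl xpredT) // => w; apply/forall_inP => v; by rewrite inE.
  have [->|[u uS]] := set_0Vmem S; first by apply: IHn; rewrite cards0.
  have en : (#|S :\ u| <= n)%N by move: Sn; rewrite (cardsD1 u S) uS.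
  rewrite -(setD1K uS); apply: lt_le_trans (key #|S :\ u|.+1 (S :\ u) u (ltnSn _)).
  by rewrite mulr_gt0 ?IHn //; lra.
have := Wpos #|V| setT (max_card _); rewrite lt0r => /andP[Wn0 _].
have [w wP] : exists w, [forall v in [set: V], ~~ B v w] && (mu w != 0).
  apply/existsP; apply: contraNT Wn0; rewrite negb_exists => /forallP h.
  apply/eqP/big1 => w wB; apply/eqP; have := h w; rewrite wB /=; exact: negbNE.
case/andP: wP => /forall_inP wB w0; exists w => // v; exact: wB.
Qed.

End LocalLemma.

(** * Independent transversals of sparse lists *)

Section Transversal.
Import boot.fintype boot.finset.
Variables (R : realType) (V T : finType) (H : rel T) (M : V -> {set T}) (U : {set V}) (h : R).
Hypotheses (Hsym : symmetric H) (Hirr : irreflexive H) (h0 : 0 < h).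
Hypothesis disj : forall u v, u != v -> [disjoint M u & M v].
Hypothesis clique : forall u x y, x \in M u -> y \in M u -> x != y -> H x y.
Hypothesis large : forall v, v \in U -> 4 * h <= #|M v|%:R.
Hypothesis sparse : forall v x, v \in U -> x \in M v ->
  #|[set y in \bigcup_(u in U :\ v) M u | H x y]|%:R <= h.
Implicit Types X : {set V}.

Let MU X := \bigcup_(v in X) M v.
Let TX X := [set I : {set T} | [&& indep H I, I \subset MU X & [forall v in X, I :&: M v != set0]]].

(** As [M u] is a clique, [y] is the only element of [I] in it, and deleting it leaves a transversal
    of the other lists. *)
Lemma TX_setD1 X u y : u \in X -> y \in M u ->
  (#|[set I in TX X | y \in I]| <= #|TX (X :\ u)|)%N.
Proof.
move=> uX yu; rewrite -(card_in_imset (f := fun I => I :\ y)); last first.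
  move=> I J; rewrite !inE => /andP[_ yI] /andP[_ yJ] e.
  by rewrite -(setD1K yI) e setD1K.
apply/subset_leq_card/subsetP => _ /imsetP[I] /[swap] ->.
rewrite !inE => /andP[/and3P[iI /subsetP IM /forall_inP IX] yI]; apply/and3P; split.
- exact: indepS (subsetDl _ _) iI.
- apply/subsetP => z /setD1P[zy zI]; have /bigcupP[v vX zv] := IM z zI.
  apply/bigcupP; exists v => //; rewrite !inE vX andbT; apply: contraNneq zy => vu.
  apply: contraT => zy; have := clique yu; rewrite -vu in yu *.
  have Hzy : H z y by apply: (clique zv).
  by have /forall_inP/(_ z zI)/forall_inP/(_ y yI) := iI; rewrite Hzy.
- apply/forall_inP => v /setD1P[vu vX]; have /set0Pn[z /setIP[zI zv]] := IX v vX.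
  apply/set0Pn; exists z; rewrite !inE zI zv !andbT.
  by apply: contraTneq zv => ->; have /pred0P/(_ y)/= := disj vu; rewrite yu andbT => ->.
Qed.

Lemma TX_setU1 X v : X \subset U -> v \in U -> v \notin X ->
  (\sum_(x in M v) #|[set I in TX X | [forall y in I, ~~ H x y]]| <= #|TX (v |: X)|)%N.
Proof.
move=> XU vU vX.
have MvX (I : {set T}) x : I \subset MU X -> x \in M v -> x \notin I.
  move=> /subsetP IM xv; apply/negP => /IM /bigcupP[u uX xu].
  have uv : u != v by apply: contraTneq uX => ->.
  by have /pred0P/(_ x)/= := disj uv; rewrite xu xv.
pose P := [set q : T * {set T} | [&& q.1 \in M v, q.2 \in TX X & [forall y in q.2, ~~ H q.1 y]]].
have -> : (\sum_(x in M v) #|[set I in TX X | [forall y in I, ~~ H x y]]| = #|P|)%N.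
  rewrite -sum1_card; rewrite (eq_bigl (fun q : T * {set T} => (q.1 \in M v) &&
    ((q.2 \in TX X) && [forall y in q.2, ~~ H q.1 y]))); last by move=> q; rewrite inE.
  rewrite -(pair_big_dep (fun x => x \in M v) (fun x I => (I \in TX X) && [forall y in I, ~~ H x y]) (fun _ _ => 1%N)) /=.
  by apply: eq_bigr => x _; rewrite -sum1_card; apply: eq_bigl => I; rewrite inE.
rewrite -(card_in_imset (f := fun q : T * {set T} => q.1 |: q.2)); last first.
  move=> [x I] [y J]; rewrite !inE /= => /and3P[xv /and3P[_ IX _] _] /and3P[yv /and3P[_ JX _] _] e.
  have exy : x = y.
    have : x \in y |: J by rewrite -e setU11.
    by rewrite inE (negPf (MvX _ _ JX xv)) orbF => /set1P.
  rewrite -exy in yv e *; congr (_, _).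
  by rewrite -(setU1K (MvX _ _ IX xv)) e setU1K // (MvX _ _ JX yv).
apply/subset_leq_card/subsetP => _ /imsetP[[x I]] /[swap] -> /=.
rewrite !inE /= => /and3P[xv /and3P[/forall_inP iI IM /forall_inP IX] /forall_inP xI].
apply/and3P; split.
- apply/forall_inP => y /setU1P[->|yI]; apply/forall_inP => z /setU1P[->|zI].
  + by rewrite Hirr.
  + exact: xI.
  + by rewrite Hsym xI.
  + by have /forall_inP := iI y yI; apply.
- rewrite subUset sub1set; apply/andP; split; first by apply/bigcupP; exists v; rewrite ?setU11.
  apply: subset_trans IM _; apply/subsetP => z /bigcupP[u uX zu].
  by apply/bigcupP; exists u; rewrite // inE uX orbT.
- apply/forall_inP => u /setU1P[->|uX]; apply/set0Pn.
    by exists x; rewrite !inE eqxx.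
  by have /set0Pn[z /setIP[zI zu]] := IX u uX; exists z; rewrite !inE zI orbT.
Qed.

(* Rosenfeld counting: each further list multiplies the number of transversals by at
   least [2 h], half the least list size. *)
Lemma card_TX n : forall X v, (#|X| < n)%N -> X \subset U -> v \in U -> v \notin X ->
  2 * h * #|TX X|%:R <= #|TX (v |: X)|%:R :> R.
Proof.
elim: n => // n IH X v; rewrite ltnS => Xn XU vU vX.
have := TX_setU1 XU vU vX; rewrite -(ler_nat R) natr_sum => ub.
refine (le_trans _ ub).
apply: (@le_trans _ _ (\sum_(x in M v) #|TX X|%:R / 2)).
  rewrite sumr_const -mulr_natl.
  have := large vU; have : 0 <= #|TX X|%:R :> R by []; nra.
apply: ler_sum => x xv.
pose Y := [set y in MU X | H x y].
have Yh : #|Y|%:R <= h.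
  apply: le_trans (sparse vU xv); rewrite ler_nat; apply/subset_leq_card/subsetP => y.
  rewrite !inE => /andP[/bigcupP[u uX yu] ->]; rewrite andbT; apply/bigcupP; exists u => //.
  by rewrite !inE (subsetP XU) // andbT; apply: contraTneq uX => ->.
have split : (#|TX X| <= #|[set I in TX X | [forall y in I, ~~ H x y]]| +
    \sum_(y in Y) #|[set I in TX X | y \in I]|)%N.
  have -> : (\sum_(y in Y) #|[set I in TX X | y \in I]| =
     \sum_(I in TX X) \sum_(y in Y) (y \in I))%N.
    rewrite exchange_big; apply: eq_bigr => y _; rewrite -sum1_card big_mkcond [RHS]big_mkcond.
    by apply: eq_bigr => I _; rewrite inE; case: (I \in TX X); case: (y \in I).
  rewrite -!sum1_card; rewrite [X in (_ <= X + _)%N]big_mkcond [X in (_ <= _ + X)%N]big_mkcond.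
  rewrite [X in (X <= _)%N]big_mkcond -big_split; apply: leq_sum => I _ /=.
  have -> : (I \in [set I0 in TX X | [forall y in I0, ~~ H x y]]) =
    (I \in TX X) && [forall y in I, ~~ H x y] by rewrite in_set.
  case IX: (I \in TX X) => //=; case: (boolP [forall y in I, ~~ H x y]) => //=.
  rewrite negb_forall_in => /exists_inP[y yI]; rewrite negbK => Hxy.
  rewrite (bigD1 y) /= ?yI //.
  rewrite inE Hxy andbT; move: IX; rewrite inE => /and3P[_ /subsetP IM _]; exact: IM.
(* By induction at most a fraction 1/(2h) of the transversals contains a given [y]. The at most [h]
   conflicts of [x] thus spoil at most half, and the 4h choices of [x] yield the factor 2h. *)
have each y : y \in Y -> #|[set I in TX X | y \in I]|%:R <= #|TX X|%:R / (2 * h) :> R.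
  rewrite inE => /andP[/bigcupP[u uX yu] _]; rewrite ler_pdivlMr ?mulr_gt0 // mulrC.
  apply: (@le_trans _ _ (2 * h * #|TX (X :\ u)|%:R)).
    by rewrite ler_wpM2l ?mulr_ge0 ?(ltW h0) // ler_nat TX_setD1.
  rewrite -{2}(setD1K uX); apply: IH; rewrite ?setD11 ?(subsetP XU) //.
    by apply: leq_trans Xn; rewrite [X in (_ < X)%N](cardsD1 u) uX.
  by apply: subset_trans XU; rewrite subsetDl.
have : \sum_(y in Y) #|[set I in TX X | y \in I]|%:R <= #|TX X|%:R / 2 :> R.
  apply: (@le_trans _ _ (\sum_(y in Y) #|TX X|%:R / (2 * h))); first exact: ler_sum.
  rewrite sumr_const -[_ *+ #|Y|]mulr_natl.
  have -> : #|TX X|%:R / 2 = h * (#|TX X|%:R / (2 * h)) :> R by field; rewrite gt_eqF.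
  by rewrite ler_wpM2r // divr_ge0 // mulr_ge0 // ltW.
move: split; rewrite -(ler_nat R) natrD natr_sum; lra.
Qed.

Lemma independent_transversal : exists I : {set T},
  [/\ indep H I, I \subset \bigcup_(v in U) M v & forall v, v \in U -> I :&: M v != set0].
Proof.
suff /(_ U (subxx U))/card_gt0P[I] : forall X, X \subset U -> (0 < #|TX X|)%N.
  by rewrite inE => /and3P[iI IM /forall_inP IX]; exists I.
move=> X; elim: {X}#|X| {-2}X (erefl #|X|) => [|n IHn] X en XU.
  rewrite (cards0_eq en); apply/card_gt0P; exists set0.
  by rewrite inE indep0 sub0set /=; apply/forall_inP => v; rewrite inE.
have [v vX] : exists v, v \in X by apply/set0Pn; rewrite -cards_eq0 en.
have XU' : X :\ v \subset U by apply: subset_trans XU; rewrite subsetDl.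
have en' : #|X :\ v| = n by apply/eqP; rewrite -eqSS -en [eqbRHS](cardsD1 v) vX.
rewrite -(ltr0n R) -(setD1K vX).
have := @card_TX #|X :\ v|.+1 (X :\ v) v (ltnSn _) XU' (subsetP XU v vX).
rewrite setD11 => /(_ isT); apply: lt_le_trans.
by rewrite !mulr_gt0 // ltr0n IHn.
Qed.

End Transversal.

(** * Flaws of hard-core sets in a cover *)

Section PartialCover.
Import boot.fintype boot.finset.
Variables (R : realType) (V HT : finType) (G : rel V) (H : rel HT) (L : V -> {set HT}).
Hypotheses (sG : simple_graph G) (Hsym : symmetric H) (Hirr : irreflexive H).
Hypothesis disj : forall u v, u != v -> [disjoint L u & L v].
Hypothesis clique : forall u x y, x \in L u -> y \in L u -> x != y -> H x y.
Hypothesis edgeG : forall u v x y, u != v -> x \in L u -> y \in L v -> H x y -> G u v.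
Hypothesis matching : forall u v, G u v -> forall x, x \in L u -> (#|[set y in L v | H x y]| <= 1)%N.
Implicit Types (u v : V) (S : {set V}) (x y : HT) (I J K F : {set HT}).

Definition nb u x : {set HT} := nbhd H x :&: \bigcup_(v | v != u) L v.
Definition free I u : {set HT} := [set x in L u | I :&: nb u x == set0].
(* [avail H I (nb u x)] contains every conflict of the free colour [x] with the colours
   left at the vertices uncoloured by [I]. *)
Definition flaw (h : R) u I : bool := (I :&: L u == set0) &&
  ((#|free I u|%:R < 4 * h) || [exists x in free I u, h < #|avail H I (nb u x)|%:R]).
Definition cl (S : {set V}) : {set V} := S :|: \bigcup_(v in S) nbhd G v.

Lemma L_inj u v x : x \in L u -> x \in L v -> u = v.
Proof.
move=> xu xv; apply/eqP; apply: contraT => /disj /pred0P/(_ x) /=.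
by rewrite xu xv.
Qed.

Lemma nbP u x y : x \in L u -> y \in nb u x -> exists v, [/\ G u v, v != u & y \in L v].
Proof.
move=> xu; rewrite !inE => /andP[Hxy /bigcupP[v vu yv]]; exists v; split=> //.
by apply: edgeG xu yv Hxy; rewrite eq_sym.
Qed.

Lemma mem_nb u v x y : v != u -> y \in L v -> H x y -> y \in nb u x.
Proof. by move=> vu yv Hxy; rewrite !inE Hxy; apply/bigcupP; exists v. Qed.

Lemma match_inj u v x y z : G u v -> x \in L u -> y \in L v -> z \in L v ->
  H x y -> H x z -> y = z.
Proof.
move=> Guv xu yv zv Hy Hz; apply/eqP; apply: contraT => yz.
have := matching Guv xu; rewrite leqNgt => /negP; case.
rewrite (cardsD1 y) (cardsD1 z) !inE yv Hy zv Hz eq_sym yz /=; lia.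
Qed.

Lemma nb_disjoint u x y : x \in L u -> y \in L u -> x != y -> [disjoint nb u x & nb u y].
Proof.
move=> xu yu xy; apply/pred0P => z /=; apply/negP => /andP[zx zy].
have [v [Guv vu zv]] := nbP xu zx.
move: zx zy; rewrite !inE => /andP[Hxz _] /andP[Hyz _].
have Gvu : G v u by rewrite sG.1.
case/eqP: xy; apply: (match_inj Gvu zv xu yu); by rewrite Hsym.
Qed.

(** [x] has at most one neighbour in each other list, so sending a colour to its vertex embeds [F]
    into the neighbourhood of [u] and maps edges of [H] to edges of [G]. Sparsity of [G] is
    inherited. *)
Lemma nb_sparse (d : R) u x F : x \in L u -> F \subset nb u x ->
  (forall A : {set V}, A \subset nbhd G u -> (degsum G A)%:R <= d * #|A|%:R) ->
  (degsum H F)%:R <= d * #|F|%:R.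
Proof.
move=> xu /subsetP FN sp.
pose pi y := odflt u [pick v | y \in L v].
have piP y v : y \in L v -> pi y = v.
  by rewrite /pi => yv; case: pickP => [w yw|/(_ v)]; [exact: L_inj yw yv|rewrite yv].
have piF y : y \in F -> G u (pi y) /\ y \in L (pi y).
  by move=> /FN/(nbP xu)[v [Guv _ yv]]; rewrite (piP _ _ yv).
have pi_inj : {in F &, injective pi}.
  move=> y z yF zF e; have [Gy yL] := piF y yF; have [Gz zL] := piF z zF.
  rewrite -e in zL; apply: (match_inj Gy xu yL zL).
    by have := FN y yF; rewrite !inE => /andP[].
  by have := FN z zF; rewrite !inE => /andP[].
have piN : pi @: F \subset nbhd G u.
  by apply/subsetP => _ /imsetP[y /piF[Gy _] ->]; rewrite inE.
have := sp _ piN; rewrite card_in_imset //; apply: le_trans.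
rewrite ler_nat /degsum big_imset //=; apply: leq_sum => y yF.
rewrite -(card_in_imset (f := pi) (D := nbhd H y :&: F)); last first.
  by move=> z w /setIP[_ zF] /setIP[_ wF]; apply: pi_inj.
apply/subset_leq_card/subsetP => _ /imsetP[z /setIP[] /[!inE] Hyz zF ->].
rewrite imset_f // andbT; have [_ yL] := piF y yF; have [_ zL] := piF z zF.
apply: edgeG yL zL (Hyz); apply: contraTneq (Hyz) => e.
by rewrite (pi_inj y z yF zF e) Hirr.
Qed.

Lemma indep_card_le1 I u : indep H I -> (#|I :&: L u| <= 1)%N.
Proof.
move=> /forall_inP iI; rewrite leqNgt; apply/negP => /card_gt1P[x [y []]].
move=> /setIP[xI xu] /setIP[yI yu] xy.
by have /forall_inP/(_ y yI) := iI x xI; rewrite (clique xu yu xy).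
Qed.

Lemma card_setI_sum (T : finType) (A B : {set T}) :
  #|A :&: B| = (\sum_(y in A) (y \in B))%N.
Proof.
rewrite -sum1_card big_mkcond [RHS]big_mkcond; apply: eq_bigr => y _.
by rewrite in_setI; case: (y \in A); case: (y \in B).
Qed.

Lemma card_sum_lists I : I \subset \bigcup_v L v -> #|I| = (\sum_v #|I :&: L v|)%N.
Proof.
move=> /subsetP IL.
under eq_bigr => v _ do rewrite card_setI_sum.
rewrite exchange_big -sum1_card; apply: eq_bigr => x /IL/bigcupP[v _ xv].
rewrite (bigD1 v) //= xv big1 // => w wv.
by case xw: (x \in L w) => //; rewrite (L_inj xw xv) eqxx in wv.
Qed.

(** A neighbour of [u] carries at most one colour of [I], and that colour is matched to at most one
    colour of [L u]. *)
Lemma sum_nb_le I u : indep H I ->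
  (\sum_(x in L u) #|I :&: nb u x| <= deg G u)%N.
Proof.
move=> iI; apply: (@leq_trans (\sum_(v in nbhd G u) #|I :&: L v|)).
  have -> : (\sum_(x in L u) #|I :&: nb u x| = \sum_(x in L u) \sum_(v in nbhd G u) #|I :&: L v :&: nb u x|)%N.
    apply: eq_bigr => x xu.
    under eq_bigr => v _ do rewrite setIAC card_setI_sum.
    rewrite exchange_big -sum1_card; apply: eq_bigr => y /setIP[_ /(nbP xu)[v [Guv _ yv]]].
    rewrite (bigD1 v) ?inE //= yv big1 // => w /andP[_ wv].
    by case yw: (y \in L w) => //; rewrite (L_inj yw yv) eqxx in wv.
  rewrite exchange_big; apply: leq_sum => v; rewrite inE => Guv.
  under eq_bigr => x _ do rewrite card_setI_sum.
  rewrite exchange_big -sum1_card; apply: leq_sum => y /setIP[_ yv].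
  have [[x /andP[xu yx]]|none] := pselect (exists x, (x \in L u) && (y \in nb u x)).
    rewrite (bigD1 x) //= yx big1 // => z /andP[zu zx].
    case yz: (y \in nb u z) => //.
    by have /pred0P/(_ y)/= := nb_disjoint zu xu zx; rewrite yz yx.
  rewrite big1 // => x xu; case yx: (y \in nb u x) => //; case: none.
  by exists x; rewrite xu.
rewrite /deg -[#|nbhd G u|]sum1_card; apply: leq_sum => v _; exact: indep_card_le1.
Qed.

Lemma card_cl S : (#|cl S| <= #|S| * (maxdeg G).+1)%N.
Proof.
rewrite mulnS; apply: leq_trans (leq_card_setU _ _) _; rewrite leq_add2l.
apply: (@leq_trans (\sum_(v in S) #|nbhd G v|)).
  elim/big_rec2: _ => [|v X n _ h]; first by rewrite cards0.
  by apply: leq_trans (leq_card_setU _ _) _; rewrite leq_add2l.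
rewrite -sum_nat_const; apply: leq_sum => v _.
exact: (@leq_bigmax _ (fun u => deg G u)).
Qed.

Lemma mem_cl S v w : v \in S -> G v w -> w \in cl S.
Proof. by move=> vS Gvw; rewrite inE; apply/orP; right; apply/bigcupP; exists v; rewrite ?inE. Qed.

Lemma sub_cl S : S \subset cl S.
Proof. exact: subsetUl. Qed.

(** A flaw at [v] reads [I] up to distance two, because availability of a neighbouring colour
    depends on that colour's own neighbours. [K] lies at distance one from [u], hence radius
    three. *)
Lemma flaw_local h u v J K : v \notin cl (cl (cl [set u])) ->
  K \subset \bigcup_(w in nbhd G u) L w -> flaw h v (J :|: K) = flaw h v J.
Proof.
move=> vN /subsetP KL.
have KP y : y \in K -> exists2 w, w \in cl [set u] & y \in L w.
  move=> /KL/bigcupP[w]; rewrite inE => Guw yw; exists w => //.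
  by apply: mem_cl Guw; rewrite set11.
have [s1 s2] := (subsetP (sub_cl (cl [set u])), subsetP (sub_cl (cl (cl [set u])))).
have Gsym := sG.1.
have eL : (J :|: K) :&: L v = J :&: L v.
  rewrite setIUl (_ : K :&: L v = set0) ?setU0 //; apply/setP => y; rewrite !inE.
  apply/negP => /andP[/KP[w wu yw] yv]; case/negP: vN.
  by rewrite -(L_inj yw yv); apply/s2/s1.
have eN x : x \in L v -> (J :|: K) :&: nb v x = J :&: nb v x.
  move=> xv; rewrite setIUl (_ : K :&: nb v x = set0) ?setU0 //; apply/setP => y.
  rewrite in_setI in_set0; apply/negP => /andP[/KP[w wu yw] /(nbP xv)[w' [Gvw _ yw']]].
  case/negP: vN; apply/s2; rewrite -(L_inj yw yw') in Gvw.
  by apply: (mem_cl wu); rewrite Gsym.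
have eF : free (J :|: K) v = free J v.
  by apply/setP => x; rewrite !in_set; case xv: (x \in L v) => //=; rewrite eN.
rewrite /flaw eL eF; congr (_ && (_ || _)); apply: eq_existsb => x.
case xv: (x \in free J v) => //=; congr (h < #|pred_of_set _|%:R).
move: xv; rewrite in_set => /andP[xv _]; apply/setP => y; rewrite !in_avail.
case yN: (y \in nb v x) => //=; have [w' [Gvw' _ yw']] := nbP xv yN.
apply/forall_inP/forall_inP => hJ z; first by move=> zJ; apply: hJ; rewrite inE zJ.
rewrite inE => /orP[/hJ//|zK]; apply/negP => Hyz; have [w wu zw] := KP z zK.
case/negP: vN; have [e|ne] := eqVneq w' w.
  by apply/s2; apply: (mem_cl wu); rewrite -e Gsym.
apply: (@mem_cl _ w'); last by rewrite Gsym.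
by apply: (mem_cl wu); rewrite Gsym; exact: edgeG Hyz.
Qed.

(** The first term is Markov's inequality for the exponential moment, against few free colours; the
    second is a union bound over [L u], against a free colour with many available neighbours. *)
Lemma flaw_prob (h l r kap d Y0 D delta : R) u (g : {set HT} -> R) :
  0 < l -> 0 <= r -> 0 <= Y0 -> 0 <= kap <= 1 -> r * Y0 <= expR (- Y0) / 2 ->
  (let mu := l * expR (- r) in l * kap <= mu / (1 + mu) * expR (- (d * ln (1 + mu)))) ->
  (forall A : {set V}, A \subset nbhd G u -> (degsum G A)%:R <= d * #|A|%:R) ->
  (deg G u)%:R <= D -> 0 <= delta ->
  (forall x F, x \in L u -> F \subset nb u x -> h < #|F|%:R -> 1 <= delta * Zs H l F) ->
  (forall I, 0 <= g I) ->
  (forall J K, K \subset \bigcup_(w in nbhd G u) L w -> g (J :|: K) = g J) ->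
  \sum_I hc H l I * (g I * (flaw h u I)%:R) <=
  (expR (4 * h + r * D) * expR (- (r * (kap * Y0))) ^+ #|L u| + delta * #|L u|%:R) *
    \sum_I hc H l I * g I.
Proof.
move=> l0 r0 Y00 k01 rY hk sp dD delta0 hdelta g0 gA; have l0' := ltW l0.
(* The event that [u] is uncoloured joins the weight: [nb u x] avoids [L u], so changing [I] there
   does not affect it. *)
pose g1 I := g I * (I :&: L u == set0)%:R.
have g10 I : 0 <= g1 I by rewrite mulr_ge0.
have nbL x K : x \in L u -> K \subset nb u x -> K \subset \bigcup_(w in nbhd G u) L w /\ K :&: L u = set0.
  move=> xu /subsetP KN; split.
    by apply/subsetP => y /KN/(nbP xu)[v [Guv _ yv]]; apply/bigcupP; exists v; rewrite ?inE.
  apply/setP => y; rewrite !inE; apply/negP => /andP[/KN/(nbP xu)[v [_ vu yv]] yu].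
  by rewrite (L_inj yv yu) eqxx in vu.
have g1A x J K : x \in L u -> K \subset nb u x -> g1 (J :|: K) = g1 J.
  by move=> xu /(nbL x K xu)[KL K0]; rewrite /g1 gA // setIUl K0 setU0.
have sum_g1 : \sum_I hc H l I * g1 I <= \sum_I hc H l I * g I.
  apply: ler_sum => I _; rewrite ler_wpM2l ?hc_ge0 // ler_piMr //.
  by case: (_ == _).
pose f (x : HT) K := expR (- ((K == set0)%:R + r * #|K|%:R)).
have few : \sum_I hc H l I * (g1 I * \prod_(x in L u) f x (I :&: nb u x)) <=
    expR (- (r * (kap * Y0))) ^+ #|L u| * \sum_I hc H l I * g1 I.
  apply: (hc_prod_le Hsym l0' (expR_ge0 _) _ _ _ g10 g1A).
  - by move=> x y; apply: nb_disjoint.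
  - by move=> x K; rewrite expR_ge0.
  - move=> x F xu FN; apply: (sum_hc_expR_le Hsym Hirr l0 r0 Y00 k01 rY _ hk).
    exact: nb_sparse xu FN sp.
have many x : x \in L u ->
   \sum_I hc H l I * (g1 I * ((I :&: nb u x == set0) && (h < #|avail H I (nb u x)|%:R))%:R) <=
   delta * \sum_I hc H l I * g1 I.
  move=> xu; apply: (hc_avail_le Hsym (P := fun F => h < #|F|%:R) l0' _ delta0 g10).
    by move=> F FN hF; apply: hdelta xu FN hF.
  by move=> J K; apply: g1A.
have sg0 : 0 <= \sum_I hc H l I * g1 I.
  by apply: sumr_ge0 => I _; rewrite mulr_ge0 ?hc_ge0.
have few' := ler_wpM2l (expR_ge0 (4 * h + r * D)) few.
have many' := ler_sum (index_enum HT) (P := mem (L u)) many.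
rewrite sumr_const -[_ *+ #|L u|]mulr_natr in many'.
apply: (@le_trans _ _ ((expR (4 * h + r * D) * expR (- (r * (kap * Y0))) ^+ #|L u| +
   delta * #|L u|%:R) * \sum_I hc H l I * g1 I)); last first.
  rewrite ler_wpM2l // addr_ge0 ?mulr_ge0 ?exprn_ge0 ?expR_ge0 //.
rewrite mulrDl -mulrA [delta * _ * _]mulrAC.
apply: le_trans (lerD few' many').
rewrite mulr_sumr exchange_big -big_split; apply: ler_sum => I _ /=.
rewrite -!mulr_sumr [expR _ * (hc _ _ _ * _)]mulrCA -mulrDr.
have [iI|/negPf iI] := boolP (indep H I); last by rewrite /hc iI !mul0r.
rewrite ler_wpM2l ?hc_ge0 // [expR _ * (g1 I * _)]mulrCA -mulrDr.
rewrite /flaw; case I0: (I :&: L u == set0); last first.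
  by rewrite /g1 I0 /= !mulr0 mul0r.
rewrite /g1 I0 mulr1 /= ler_wpM2l //.
have sum0 : 0 <= \sum_(x in L u) ((I :&: nb u x == set0) && (h < #|avail H I (nb u x)|%:R))%:R :> R.
  by apply: sumr_ge0.
have prod0 : 0 <= \prod_(x in L u) f x (I :&: nb u x).
  by apply: prodr_ge0 => x _; apply: expR_ge0.
have [fw|_] /= := boolP (#|free I u|%:R < 4 * h); last first.
  have [/exists_inP[x]|_] /= :=
    boolP [exists x in free I u, h < #|avail H I (nb u x)|%:R]; last first.
    by rewrite addr_ge0 // mulr_ge0 ?expR_ge0.
  rewrite in_set => /andP[xu Ix] hx; rewrite [X in _ + X](bigD1 x) //= Ix hx /=.
  rewrite addrCA lerDl addr_ge0 ?mulr_ge0 ?expR_ge0 //.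
  by apply: sumr_ge0.
apply: (@le_trans _ _ (expR (4 * h + r * D) * \prod_(x in L u) f x (I :&: nb u x))); last first.
  by rewrite lerDl.
(* With fewer than 4h free colours and at most [D] occupied conflicts, the product of the [f x] is
   at least e^(-(4h + rD)). *)
rewrite /f -expR_sum -expRD -[X in X <= _]expR0 ler_expR sumrN big_split /= -mulr_sumr.
have -> : \sum_(x in L u) (I :&: nb u x == set0)%:R = #|free I u|%:R :> R.
  rewrite -sum1_card natr_sum big_mkcond [RHS]big_mkcond; apply: eq_bigr => x _.
  by rewrite in_set; case: (x \in L u) => //=; case: eqP.
have : r * \sum_(x in L u) #|I :&: nb u x|%:R <= r * D.
  rewrite ler_wpM2l // -natr_sum; apply: le_trans dD; rewrite ler_nat; exact: sum_nb_le.
lra.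
Qed.

Lemma flawless_colouring (h : R) I : 0 < h -> indep H I -> I \subset \bigcup_v L v ->
  (forall v, ~~ flaw h v I) -> cover_colourable V H.
Proof.
move=> h0 iI IL nf; pose U := [set v | I :&: L v == set0].
have IP x : x \in I -> exists v, x \in L v.
  by move=> /(subsetP IL)/bigcupP[v _ xv]; exists v.
have freeL v x : x \in free I v -> x \in L v by rewrite in_set => /andP[].
have noI v x y : v \in U -> x \in free I v -> y \in I -> ~~ H x y.
  rewrite !in_set => /eqP Iv /andP[xv /eqP Ix] yI; apply/negP => Hxy.
  have [w yw] := IP y yI; have wv : w != v.
    apply/eqP => e; have : y \in I :&: L v by rewrite inE yI -e.
    by rewrite Iv inE.
  have : y \in I :&: nb v x by rewrite inE yI (mem_nb wv yw Hxy).
  by rewrite Ix inE.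
have [||v vU|v x vU xf|I1 [iI1 I1L I1U]] :=
    @independent_transversal R V HT H (free I) U h Hsym Hirr h0.
- move=> u v uv; apply: disjointWl (disjointWr _ (disj uv)); apply/subsetP => x; exact: freeL.
- by move=> u x y /freeL xu /freeL; apply: clique xu.
- have := nf v; rewrite /flaw; move: vU; rewrite in_set => -> /=.
  by rewrite negb_or -leNgt => /andP[].
- have := nf v; rewrite /flaw; move: (vU); rewrite in_set => -> /=.
  rewrite negb_or => /andP[_]; rewrite negb_exists_in => /forall_inP/(_ x xf).
  rewrite -leNgt; apply: le_trans; rewrite ler_nat; apply/subset_leq_card/subsetP => y.
  rewrite in_set in_avail => /andP[/bigcupP[u /setD1P[uv uU] yf] Hxy].
  rewrite (mem_nb uv (freeL _ _ yf) Hxy) /=.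
  by apply/forall_inP => z; apply: noI yf.
exists (I :|: I1).
have iU : indep H (I :|: I1).
  have /forall_inP iI' := iI; have /forall_inP iI1' := iI1.
  have I1I x y : x \in I1 -> y \in I -> ~~ H x y.
    by move=> /(subsetP I1L)/bigcupP[v vU xf]; apply: noI xf.
  apply/forall_inP => x /setUP[xI|xI]; apply/forall_inP => y /setUP[yI|yI].
  - by have /forall_inP := iI' x xI; apply.
  - by rewrite Hsym I1I.
  - exact: I1I.
  - by have /forall_inP := iI1' x xI; apply.
split=> //; rewrite card_sum_lists.
  rewrite -sum1_card; apply: eq_bigr => v _; apply/eqP; rewrite eqn_leq indep_card_le1 //=.
  rewrite card_gt0; have [vU|] := boolP (v \in U).
    have /set0Pn[x /setIP[xI xf]] := I1U v vU.
    by apply/set0Pn; exists x; rewrite !inE xI (freeL _ _ xf) orbT.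
  rewrite in_set => /set0Pn[x /setIP[xI xv]].
  by apply/set0Pn; exists x; rewrite !inE xI xv.
rewrite subUset IL; apply: subset_trans I1L _; apply/subsetP => x /bigcupP[v _ /freeL xv].
by apply/bigcupP; exists v.
Qed.

End PartialCover.

(** * Numerical estimates for the flaw probability *)

Section CorrespondenceColouring.
Import boot.fintype boot.finset.
Variable R : realType.

Lemma expR_ge_sqr (x : R) : 0 <= x -> x ^+ 2 / 4 <= expR x.
Proof.
move=> x0; have -> : expR x = expR (x / 2) ^+ 2 by rewrite -expRM_natl; congr expR; field.
have := expR_ge1Dx (x / 2); have := expR_gt0 (x / 2); nra.
Qed.

Lemma expR1_le4 : expR 1 <= 4 :> R.
Proof.
have h : 1 / 2 <= expR (- (1 / 2)) :> R by apply: le_trans (expR_ge1Dx _); lra.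
have -> : expR 1 = expR (- (- (1 / 2) + - (1 / 2))) :> R by congr expR; field.
rewrite expRN expRD invf_ple ?posrE ?mulr_gt0 ?expR_gt0 //; nra.
Qed.

(** The condition of the local lemma for flaw probability Delta^-4 and balls of radius three. *)
Lemma ball_prob_bound (x : R) : 32 <= x -> 4 * x ^- 4 * (x + 1) ^+ 3 <= 1.
Proof.
move=> x32; have x0 : 0 < x by lra.
rewrite mulrAC ler_pdivrMr ?exprn_gt0 // mul1r.
apply: (@le_trans _ _ (4 * (2 * x) ^+ 3)).
  by rewrite ler_wpM2l // lerXn2r ?nnegrE //; lra.
have -> : 4 * (2 * x) ^+ 3 = 32 * x ^+ 3 by ring.
by rewrite [x ^+ 4]exprS ler_wpM2r // exprn_ge0 // ltW.
Qed.

(* The lists are truncated so that [m <= 3 Delta^2] in the relevant case. *)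
Lemma list_prob_bound (x m : R) : 32 <= x -> m <= 3 * (x * x) ->
  expR (- (10 * ln x)) * m <= expR (- (5 * ln x)).
Proof.
move=> x32 mx; have x0 : 0 < x by lra.
have -> : expR (- (10 * ln x)) = expR (- (5 * ln x)) * expR (- (5 * ln x)).
  by rewrite -expRD; congr expR; ring.
rewrite -mulrA ler_piMr ?expR_ge0 // expRN expRM_natl lnK ?posrE //.
rewrite ler_pdivrMl ?exprn_gt0 // mulr1; apply: le_trans mx _.
have -> : x ^+ 5 = x ^+ 3 * (x * x) by ring.
rewrite ler_wpM2r ?mulr_ge0 ?(ltW x0) //.
have : 1 <= x * x by nra.
rewrite !exprS expr0; nra.
Qed.

(** The right-hand side is l e^(-r) (1+mu)^(-(d+1)), and (d+1) ln(1+mu) <= 2Kl = 2 eta. This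
    supplies the admissible value of [kap]. *)
Lemma fugacity_shift (eta K d l r : R) : 0 < eta -> 0 < K -> 0 <= d -> d + 1 <= 2 * K ->
  l = eta / K -> 0 <= r ->
  let mu := l * expR (- r) in
  l * expR (- (r + 2 * eta)) <= mu / (1 + mu) * expR (- (d * ln (1 + mu))).
Proof.
move=> e0 K0 d0 dK lE r0 /=; set mu := l * expR (- r).
have l0 : 0 < l by rewrite lE divr_gt0.
have mu0 : 0 < mu by rewrite mulr_gt0 ?expR_gt0.
have p1 : 0 < 1 + mu by rewrite ltr_wpDr // ltW.
have mul : mu <= l.
  by rewrite ler_piMr ?(ltW l0) // -[leRHS]expR0 ler_expR oppr_le0.
have -> : mu / (1 + mu) * expR (- (d * ln (1 + mu))) =
    l * expR (- (r + (d + 1) * ln (1 + mu))).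
  have -> : - (r + (d + 1) * ln (1 + mu)) = - r - ln (1 + mu) - d * ln (1 + mu) by ring.
  by rewrite expRB expRB lnK ?posrE // expRN /mu; ring.
rewrite ler_wpM2l ?(ltW l0) // ler_expR lerN2 lerD2l.
apply: (@le_trans _ _ (2 * K * l)); last by rewrite lE -mulrA [K * _]mulrC divfK ?gt_eqF.
apply: ler_pM => //; rewrite ?addr_ge0 ?ln_ge0 // ?lerDl ?(ltW mu0) //.
by apply: le_trans mul; apply: le_ln1Dx; apply: lt_trans mu0; rewrite ltrN10.
Qed.

(** The threshold is Y0 = (1-eta)X, and [r] is chosen so that r Y0 <= e^(-Y0)/2. The list size makes
    m kap Y0 >= (1+eta)D, leaving a surplus eta r D. As r D is of order e^(eta X) K Lam / X, the
    quadratic bound on the exponential and X >= 2600 eta^-4 raise the surplus to 325 K Lam / eta: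
    320 parts pay for 4h, 5 parts for the probability. *)
Lemma flaw_budget (eta K Lam D m X r kap : R) : 0 < eta -> eta <= 1 / 20 ->
  1 <= K -> 0 < Lam -> 0 < D -> X = ln (D / (K * Lam)) -> 2600 * eta ^- 4 <= X ->
  r = expR (- ((1 - eta) * X)) / (2 * X) -> kap = expR (- (r + 2 * eta)) ->
  (1 + 20 * eta) * (D / X) <= m ->
  r <= eta /\
  4 * (80 * (K * Lam) / eta) + r * D - m * (r * (kap * ((1 - eta) * X))) <= - (5 * Lam).
Proof.
move=> e0 e1 K1 Lam0 D0 XE hX rE kE hm.
have e4 : 0 < eta ^- 4 by rewrite invr_gt0 exprn_gt0.
have X0 : 0 < X by lra.
have r0 : 0 < r by rewrite rE divr_gt0 ?expR_gt0 ?mulr_gt0.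
have KL0 : 0 < K * Lam by rewrite mulr_gt0 //; lra.
have e41 : 1 <= eta * eta ^- 4.
  have -> : eta * eta ^- 4 = (eta ^+ 3)^-1 by field; rewrite gt_eqF.
  by rewrite invf_ge1 ?exprn_gt0 // exprn_ile1 // ?ltW //; lra.
have re : r <= eta.
  rewrite rE ler_pdivrMr ?mulr_gt0 //; apply: (@le_trans _ _ 1).
    by rewrite -[leRHS]expR0 ler_expR oppr_le0 mulr_ge0 ?(ltW X0) //; lra.
  have := ler_wpM2l (ltW e0) hX; lra.
split=> //.
have k1 : 1 - 3 * eta <= kap.
  by rewrite kE; apply: le_trans (expR_ge1Dx _); lra.
have hD : (1 + eta) * D <= m * (kap * ((1 - eta) * X)).
  apply: (@le_trans _ _ ((1 + 20 * eta) * (D / X) * ((1 - 3 * eta) * ((1 - eta) * X)))).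
    have -> : (1 + 20 * eta) * (D / X) * ((1 - 3 * eta) * ((1 - eta) * X)) =
      (1 + 20 * eta) * (1 - 3 * eta) * (1 - eta) * D by field; rewrite gt_eqF.
    by rewrite ler_wpM2r ?(ltW D0) //; nra.
  have ? : 0 <= D / X by rewrite divr_ge0 ?ltW.
  apply: ler_pM => //.
  - by rewrite mulr_ge0 //; lra.
  - by rewrite !mulr_ge0 ?(ltW X0) //; lra.
  - by rewrite ler_wpM2r // mulr_ge0 ?(ltW X0) //; lra.
have rD : eta ^+ 2 * X * (K * Lam) / 8 <= r * D.
  have DE : D = expR X * (K * Lam).
    by rewrite XE lnK ?posrE ?divr_gt0 // divfK // gt_eqF.
  have -> : r * D = expR (eta * X) * (K * Lam) / (2 * X).
    rewrite rE [in LHS]DE.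
    have -> : expR (- ((1 - eta) * X)) / (2 * X) * (expR X * (K * Lam)) =
       (expR (- ((1 - eta) * X)) * expR X) * (K * Lam) / (2 * X) by ring.
    by rewrite -expRD; congr (expR _ * _ / _); ring.
  have -> : eta ^+ 2 * X * (K * Lam) / 8 = (eta * X) ^+ 2 / 4 * (K * Lam) / (2 * X).
    by field; rewrite gt_eqF.
  rewrite ler_wpM2r ?invr_ge0 ?mulr_ge0 ?(ltW X0) // ler_wpM2r ?(ltW KL0) //.
  by rewrite expR_ge_sqr // mulr_ge0 ?(ltW X0) ?(ltW e0).
have main : 325 / eta * (K * Lam) <= eta * (r * D).
  apply: (@le_trans _ _ (eta * (eta ^+ 2 * X * (K * Lam) / 8))); last by rewrite ler_wpM2l ?(ltW e0).
  have -> : eta * (eta ^+ 2 * X * (K * Lam) / 8) = eta ^+ 3 / 8 * X * (K * Lam) by ring.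
  rewrite ler_wpM2r ?(ltW KL0) //.
  apply: le_trans (ler_wpM2l _ hX); last by rewrite divr_ge0 ?exprn_ge0 ?(ltW e0).
  by rewrite le_eqVlt; apply/orP; left; apply/eqP; field; rewrite gt_eqF.
have l5 : 5 * Lam <= 5 / eta * (K * Lam).
  rewrite mulrA; apply: ler_wpM2r; first exact: ltW.
  by rewrite mulrAC ler_pdivlMr //; nra.
have -> : m * (r * (kap * ((1 - eta) * X))) = r * (m * (kap * ((1 - eta) * X))) by ring.
have := ler_wpM2l (ltW r0) hD.
have -> : 4 * (80 * (K * Lam) / eta) = 320 / eta * (K * Lam) by ring.
have e1' : 325 / eta * (K * Lam) = 320 / eta * (K * Lam) + 5 / eta * (K * Lam) by ring.
move: main; rewrite e1'; lra.
Qed.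

End CorrespondenceColouring.

(** * Colouring a cover with truncated lists *)

Section SparseCover.
Import boot.fintype boot.finset.
Variables (R : realType) (V HT : finType) (G : rel V) (H : rel HT) (L : V -> {set HT}).
Hypotheses (sG : simple_graph G) (Hsym : symmetric H) (Hirr : irreflexive H).
Hypothesis disj : forall u v, u != v -> [disjoint L u & L v].
Hypothesis clique : forall u x y, x \in L u -> y \in L u -> x != y -> H x y.
Hypothesis edgeG : forall u v x y, u != v -> x \in L u -> y \in L v -> H x y -> G u v.
Hypothesis matching : forall u v, G u v -> forall x, x \in L u -> (#|[set y in L v | H x y]| <= 1)%N.

Lemma card_nb u x : x \in L u -> (#|nb H L u x| <= deg G u)%N.
Proof.
move=> xu; have NP := nbP edgeG xu.
apply: (@leq_trans (\sum_(v in nbhd G u) #|nb H L u x :&: L v|)).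
  under eq_bigr => v _ do rewrite card_setI_sum.
  rewrite exchange_big -sum1_card; apply: leq_sum => y /NP[v [Guv _ yv]].
  by rewrite (bigD1 v) ?inE //= yv.
rewrite /deg -[#|nbhd G u|]sum1_card; apply: leq_sum => v; rewrite inE => Guv.
apply: leq_trans (matching Guv xu); apply/subset_leq_card/subsetP => y.
by rewrite !inE => /andP[/andP[-> _] ->].
Qed.

Variables (k : nat) (t eta : R) (D : V -> R).
Hypotheses (k3 : (3 <= k)%N) (t2 : 1 / 2 <= t) (lp : local_path_bound G k t).
Hypotheses (e0 : 0 < eta) (e1 : eta <= 1 / 20).
Variables (K Del Lam : R) (X : V -> R).
Hypotheses (KE : K = k%:R + Num.sqrt t) (DelE : Del = (maxdeg G)%:R) (LamE : Lam = ln Del).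
Hypothesis XE : forall u, X u = ln (D u / (K * Lam)).
Hypothesis Del32 : 32 <= Del.
Hypothesis dD : forall u, (deg G u)%:R <= D u.
Hypothesis lD : forall u, expR (2600 * eta ^- 4) * (K * Lam) <= D u.
Hypothesis uD : forall u, D u <= Del * (K * Lam).
Hypothesis lL : forall u, (1 + 20 * eta) * (D u / X u) <= #|L u|%:R.
Hypothesis uL : forall u, #|L u|%:R <= (1 + 20 * eta) * (D u / X u) + 1.

Lemma truncated_cover_colouring : cover_colourable V H.
Proof.
have [D32 [eta0 eta1]] := (Del32, (e0, e1)).
have [d0 [dK K3]] := sqrtD_bound k3 t2; set d := (_ - 3 + _) in d0 dK.
rewrite -KE in dK K3; have K0 : 0 < K by lra.
have Del0 : 0 < Del by lra.
have Lam1 : 1 <= Lam.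
  rewrite LamE -[leLHS]expRK ler_ln ?posrE ?expR_gt0 //; apply: le_trans Del32.
  by have := @expR1_le4 R; lra.
have KL1 : 1 <= K * Lam by nra.
have KL0 : 0 < K * Lam by lra.
have e4 : 0 < eta ^- 4 by rewrite invr_gt0 exprn_gt0.
have D0 u : 0 < D u by apply: lt_le_trans (lD u); rewrite mulr_gt0 ?expR_gt0.
have XD u : 2600 * eta ^- 4 <= X u.
  by rewrite XE -[leLHS]expRK ler_ln ?posrE ?expR_gt0 ?divr_gt0 // ler_pdivlMr.
have e41 : 1 <= eta ^- 4.
  by rewrite invf_ge1 ?exprn_gt0 // exprn_ile1 // ?ltW //; lra.
have X1 u : 1 <= X u by have := XD u; lra.
(* The constant 80 gives h l / 8 = 10 Lam, so that [h] available colours force a partition function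
   of at least Delta^10. *)
pose l := eta / K; pose h := 80 * (K * Lam) / eta.
have l0 : 0 < l by rewrite divr_gt0.
have h0 : 0 < h by rewrite divr_gt0 // mulr_gt0.
pose r u := expR (- ((1 - eta) * X u)) / (2 * X u).
pose kap u := expR (- (r u + 2 * eta)).
have X0 u : 0 < X u := lt_le_trans ltr01 (X1 u).
have r0 u : 0 <= r u by rewrite divr_ge0 ?expR_ge0 // mulr_ge0 // ltW.
have K1 : 1 <= K by lra.
have Lam0 : 0 < Lam by lra.
have bud u := flaw_budget e0 e1 K1 Lam0 (D0 u) (XE u) (XD u) (erefl (r u)) (erefl (kap u)) (lL u).
pose p := expR (- (4 * Lam)).
pose LL := \bigcup_v L v.
(* [HT] may contain colours outside all lists, since the lists may have been cut; the measure
   ignores sets using them. *)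
pose mu (I : {set HT}) : R := hc H l I * (I \subset LL)%:R.
pose Gam u := cl G (cl G (cl G [set u])).
pose N := ((maxdeg G).+1 ^ 3)%N.
have GamN u : (#|Gam u| <= N)%N.
  rewrite /N !expnSr expn0 mul1n.
  apply: leq_trans (card_cl G _) _; rewrite leq_mul2r; apply/orP; right.
  apply: leq_trans (card_cl G _) _; rewrite leq_mul2r; apply/orP; right.
  by apply: leq_trans (card_cl G _) _; rewrite cards1 mul1n.
have pE : p = Del ^- 4.
  by rewrite /p expRN expRM_natl LamE lnK.
have pN : 4 * p * N%:R <= 1.
  by rewrite pE /N natrX -[(maxdeg G).+1%:R]natr1 -DelE; apply: ball_prob_bound.
have mu0 I : 0 <= mu I by rewrite mulr_ge0 ?hc_ge0 // ltW.
have mupos : 0 < \sum_I mu I.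
  rewrite (bigD1 set0) //= {1}/mu /hc indep0 cards0 sub0set !mul1r.
  by apply: lt_le_trans ltr01 _; rewrite lerDl sumr_ge0.
have N0 : (0 < N)%N by rewrite expn_gt0.
have [I muI nf] : exists2 I, mu I != 0 & forall v, ~~ flaw H L h v I.
  apply: (@local_lemma R V {set HT} mu (flaw H L h) p N Gam mu0 mupos (expR_ge0 _) N0 pN GamN).
  move=> u S SG.
  pose g (I : {set HT}) : R := (I \subset LL)%:R * [forall v in S, ~~ flaw H L h v I]%:R.
  have -> : \sum_(I | flaw H L h u I && [forall v in S, ~~ flaw H L h v I]) mu I =
      \sum_I hc H l I * (g I * (flaw H L h u I)%:R).
    rewrite big_mkcond; apply: eq_bigr => I _; rewrite /g /mu.
    by case: (flaw H L h u I); case: [forall v in S, ~~ flaw H L h v I]; rewrite /= ?mulr1 ?mulr0.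
  have -> : \sum_(I | [forall v in S, ~~ flaw H L h v I]) mu I = \sum_I hc H l I * g I.
    rewrite big_mkcond; apply: eq_bigr => I _; rewrite /g /mu.
    by case: [forall v in S, ~~ flaw H L h v I]; rewrite /= ?mulr0 ?mulr1.
  have g0 I : 0 <= g I by rewrite mulr_ge0.
  have gA (J K' : {set HT}) : K' \subset \bigcup_(w in nbhd G u) L w -> g (J :|: K') = g J.
    move=> KL; rewrite /g subUset (_ : K' \subset LL) ?andbT; last first.
      by apply: subset_trans KL _; apply/subsetP => x /bigcupP[w _ xw]; apply/bigcupP; exists w.
    congr (_ * (nat_of_bool _)%:R); apply: eq_forallb => v.
    case vS: (v \in S) => //=; congr negb; apply: (flaw_local sG disj edgeG) KL.
    by apply/negP => vG; have /pred0P/(_ v)/= := SG; rewrite vS /= /Gam vG.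
  (* When [h] is at least Delta no colour has more than [h] conflicts and the second kind of flaw
     cannot occur. Otherwise K Lam <= Delta, which keeps the lists polynomial in Delta for the union
     bound. *)
  pose delta : R := if h < Del then expR (- (10 * Lam)) else 0.
  have delta0 : 0 <= delta by rewrite /delta; case: ifP => _; rewrite ?expR_ge0.
  have sp (A : {set V}) : A \subset nbhd G u -> (degsum G A)%:R <= d * #|A|%:R.
    exact: local_path_bound_degsum.
  have hdelta x (F : {set HT}) : x \in L u -> F \subset nb H L u x -> h < #|F|%:R ->
      1 <= delta * Zs H l F.
    move=> xu FN hF.
    have FD : #|F|%:R <= Del.
      rewrite DelE ler_nat; apply: leq_trans (subset_leq_card FN) (leq_trans (card_nb xu) _).
      exact: (@leq_bigmax _ (fun u => deg G u)).
    rewrite /delta (lt_le_trans hF FD).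
    have spF := nb_sparse Hirr disj edgeG matching xu FN sp.
    (* Here r = 1 suffices: the partition function is at least e^(l|F|/8). *)
    have hk := fugacity_shift e0 K0 d0 dK (erefl l) (@ler01 R).
    have := Zs_ratio_sparse Hsym Hirr l0 (@ler01 R) spF hk; rewrite mul1r => ratio.
    have e8 : 1 / 8 <= expR (- (1 + 2 * eta)) :> R.
      have -> : - (1 + 2 * eta) = - (1 / 2) + - (1 / 2) - 2 * eta by field.
      have := expR_ge1Dx (- (1 / 2) : R); have := expR_ge1Dx (- (2 * eta)).
      rewrite !expRD; set a := expR (- (1 / 2)); set b := expR _ => hb ha.
      have ha' : 1 / 2 <= a by lra.
      have hb' : 1 / 2 <= b by lra.
      nra.
    rewrite expRN ler_pdivlMl ?expR_gt0 // mulr1; apply: le_trans ratio.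
    apply: (@le_trans _ _ (expR (#|F|%:R * (l * expR (- (1 + 2 * eta)))))); last first.
      by rewrite ler_peMl ?expR_ge0 // Zs_ge1 // mulr_ge0 ?expR_ge0 ?(ltW l0).
    rewrite ler_expR; apply: (@le_trans _ _ (h * (l * (1 / 8)))).
      by rewrite /h /l le_eqVlt; apply/orP; left; apply/eqP; field; rewrite !gt_eqF.
    apply: ler_pM; [exact: ltW h0| |exact: ltW hF|by rewrite ler_wpM2l // ltW].
    by apply: mulr_ge0; [exact: ltW l0|exact: divr_ge0].
  have k01 : 0 <= kap u <= 1.
    rewrite expR_ge0 -[leRHS]expR0 ler_expR oppr_le0 addr_ge0 //.
    by rewrite mulr_ge0 // ltW.
  have Y00 : 0 <= (1 - eta) * X u by rewrite mulr_ge0 ?(ltW (X0 u)) //; lra.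
  have rY : r u * ((1 - eta) * X u) <= expR (- ((1 - eta) * X u)) / 2.
    have -> : r u * ((1 - eta) * X u) = (1 - eta) * (expR (- ((1 - eta) * X u)) / 2).
      by rewrite /r; field; rewrite gt_eqF.
    by rewrite ler_piMl ?divr_ge0 ?expR_ge0 //; lra.
  have hk := fugacity_shift e0 K0 d0 dK (erefl l) (r0 u).
  apply: le_trans (flaw_prob sG Hsym Hirr disj clique edgeG matching (h := h)
    l0 (r0 u) Y00 k01 rY hk sp (dD u) delta0 hdelta g0 gA) _.
  rewrite ler_wpM2r //; first by apply: sumr_ge0 => I _; rewrite mulr_ge0 ?hc_ge0 // ltW.
  have P1 : expR (4 * h + r u * D u) * expR (- (r u * (kap u * ((1 - eta) * X u)))) ^+ #|L u| <=
      expR (- (5 * Lam)).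
    rewrite -expRM_natl -expRD ler_expR mulrN; exact: (bud u).2.
  have P2 : delta * #|L u|%:R <= expR (- (5 * Lam)).
    rewrite /delta; case: ifP => [hDel|_]; last by rewrite mul0r expR_ge0.
    have KLD : K * Lam <= Del.
      apply: le_trans (ltW hDel); rewrite /h mulrAC ler_peMl ?(ltW KL0) //.
      by rewrite ler_pdivlMr //; lra.
    have mD : #|L u|%:R <= 3 * (Del * Del).
      apply: le_trans (uL u) _.
      have D2 : D u <= Del * Del by apply: le_trans (uD u) _; rewrite ler_wpM2l // ltW.
      have DX : D u / X u <= D u by rewrite ler_pdivrMr // ler_peMr // ltW.
      have : 0 <= D u / X u by rewrite divr_ge0 // ltW.
      nra.
    by rewrite LamE; apply: list_prob_bound.
  apply: le_trans (lerD P1 P2) _; rewrite /p.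
  (* Both kinds of flaw have probability at most Delta^-5, and 2 <= Delta. *)
  have -> : expR (- (4 * Lam)) = Del * expR (- (5 * Lam)).
    have -> : Del = expR Lam by rewrite LamE lnK.
    by rewrite -expRD; congr expR; ring.
  by rewrite -mulr2n -[_ *+ 2]mulr_natl ler_wpM2r ?expR_ge0 //; lra.
have [iI IL] : indep H I /\ I \subset LL.
  move: muI; rewrite /mu /hc; case: (indep H I); case: (I \subset LL) => //=;
    by rewrite ?mul0r ?mulr0 eqxx.
exact: (flawless_colouring Hsym Hirr disj clique h0 iI IL nf).
Qed.

End SparseCover.

(** * General covers and the correspondence chromatic number *)

Section CoverColouring.
Import boot.fintype boot.finset.
Variable R : realType.

Lemma exists_subset_card (T : finType) (A : {set T}) (x : R) : 0 <= x -> x <= #|A|%:R ->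
  exists B : {set T}, [/\ B \subset A, x <= #|B|%:R & #|B|%:R <= x + 1].
Proof.
move=> x0 xA.
have ex : exists n : nat, x <= n%:R by exists #|A|.
case: (ex_minnP ex) => n xn nmin.
have nA : (n <= size (enum A))%N by rewrite -cardE; apply: nmin.
exists [set y in take n (enum A)].
have -> : #|[set y in take n (enum A)]| = n.
  by rewrite cardsE (card_uniqP _) ?take_uniq ?enum_uniq // size_takel.
split=> //; first by apply/subsetP => y; rewrite inE => /mem_take; rewrite mem_enum.
case: n nmin {xn nA} => [_|n nmin]; first by rewrite addr_ge0.
rewrite -natr1 lerD2r leNgt; apply/negP => /ltW /nmin; by rewrite ltnn.
Qed.

(** As in the fractional case, [D u] is a free bound on the degree, serving the local statement and
    [chi_c] alike. Shrinking lists preserves disjointness, cliques and matchings, so they may be cut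
    to within one of the size required. *)
Lemma sparse_cover_colouring (eps : R) : 0 < eps -> exists delta0 : R, 1 < delta0 /\
  forall (V : finType) (G : rel V) (k : nat) (t : R) (D : V -> R),
  simple_graph G -> (3 <= k)%N -> 1 / 2 <= t -> local_path_bound G k t ->
  let Del : R := (maxdeg G)%:R in let K := k%:R + Num.sqrt t in
  32 <= Del -> (forall u, (deg G u)%:R <= D u) ->
  (forall u, delta0 * (K * ln Del) <= D u) -> (forall u, D u <= Del * (K * ln Del)) ->
  forall (HT : finType) (H : rel HT) (L : V -> {set HT}), dp_cover G H L ->
  (forall u, (1 + eps) * (D u / ln (D u / (K * ln Del))) <= #|L u|%:R) ->
  cover_colourable V H.
Proof.
move=> eps0; set eta := Num.min eps 1 / 20.
have e0 : 0 < eta by rewrite divr_gt0 // lt_min eps0 ltr01.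
have e1 : eta <= 1 / 20 by rewrite ler_wpM2r ?invr_ge0 // ge_min lexx orbT.
have e2 : 20 * eta <= eps.
  by rewrite /eta mulrC divfK ?pnatr_eq0 // ge_min lexx.
have e4 : 0 < eta ^- 4 by rewrite invr_gt0 exprn_gt0.
exists (expR (2600 * eta ^- 4)); split.
  by rewrite -[ltLHS]expR0 ltr_expR mulr_gt0.
move=> V G k t D sG k3 t2 lp Del K D32 dD lD uD HT H L.
move=> [[Hsym Hirr] [_ disj clique edgeG matching]] lL.
have [_ [_ K3]] := sqrtD_bound k3 t2.
have Lam0 : 0 < ln Del by rewrite ln_gt0 //; lra.
have KL0 : 0 < K * ln Del by rewrite mulr_gt0 //; rewrite /K; lra.
have D0 u : 0 < D u by apply: lt_le_trans (lD u); rewrite mulr_gt0 ?expR_gt0.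
have X0 u : 0 < ln (D u / (K * ln Del)).
  rewrite ln_gt0 // ltr_pdivlMr //; apply: lt_le_trans (lD u).
  by rewrite ltr_pM2r // -[ltLHS]expR0 ltr_expR mulr_gt0.
have n0 u : 0 <= (1 + 20 * eta) * (D u / ln (D u / (K * ln Del))).
  apply: mulr_ge0; first lra.
  by rewrite divr_ge0 ?(ltW (D0 u)) ?(ltW (X0 u)).
have nL u : (1 + 20 * eta) * (D u / ln (D u / (K * ln Del))) <= #|L u|%:R.
  apply: le_trans (lL u); rewrite ler_wpM2r ?lerD2l //.
  by rewrite divr_ge0 ?(ltW (D0 u)) ?(ltW (X0 u)).
have [L' L'P] : exists L' : V -> {set HT}, forall u, [/\ L' u \subset L u,
    (1 + 20 * eta) * (D u / ln (D u / (K * ln Del))) <= #|L' u|%:R &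
    #|L' u|%:R <= (1 + 20 * eta) * (D u / ln (D u / (K * ln Del))) + 1].
  have ex u := cid (exists_subset_card (n0 u) (nL u)).
  by exists (fun u => proj1_sig (ex u)) => u; exact: (proj2_sig (ex u)).
have sL u x : x \in L' u -> x \in L u by have [/subsetP h _ _] := L'P u; exact: h.
apply: (@truncated_cover_colouring R V HT G H L' sG Hsym Hirr _ _ _ _ k t eta D k3 t2 lp e0 e1
  K Del (ln Del) (fun u => ln (D u / (K * ln Del)))) => //.
- move=> u v uv; apply: disjointWl (disjointWr _ (disj u v uv)); apply/subsetP => x; exact: sL.
- by move=> u x y /sL xu /sL; apply: clique xu.
- by move=> u v x y uv /sL xu /sL; apply: edgeG uv xu.
- move=> u v Guv x /sL xu; apply: leq_trans (matching u v Guv x xu).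
  by apply/subset_leq_card/subsetP => y; rewrite !inE => /andP[/sL -> ->].
- by move=> u; have [] := L'P u.
- by move=> u; have [] := L'P u.
Qed.

Lemma archi_bound (x : R) : exists n : nat, forall m, (n <= m)%N -> x <= m%:R.
Proof.
exists (Num.bound x) => m nm; apply: le_trans (ler_norm x) _.
by apply: le_trans (ltW (archi_boundP (normr_ge0 x))) _; rewrite ?ler_nat // /Num.bound normr_id.
Qed.

Lemma local_cover_colouring (eps : R) : 0 < eps -> exists (delta0 : R) (Delta0 : nat),
  forall (V : finType) (G : rel V) (k : nat) (t : R),
  simple_graph G -> (3 <= k)%N -> 1 / 2 <= t -> local_path_bound G k t ->
  (Delta0 <= maxdeg G)%N ->
  forall (HT : finType) (H : rel HT) (L : V -> {set HT}), dp_cover G H L ->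
  (forall u : V, (1 + eps) *
     Num.max ((deg G u)%:R / ln ((deg G u)%:R / ((k%:R + Num.sqrt t) * ln (maxdeg G)%:R)))
       (delta0 / ln delta0 * (k%:R + Num.sqrt t) * ln (maxdeg G)%:R) <= #|L u|%:R) ->
  cover_colourable V H.
Proof.
move=> eps0; have [delta0 [d1 core]] := sparse_cover_colouring eps0.
have [n nP] := archi_bound (32 + delta0); exists delta0, n.
move=> V G k t sG k3 t2 lp /nP nD HT H L cov lL.
have [_ [_ K3]] := sqrtD_bound k3 t2; set K := k%:R + Num.sqrt t in K3 lL *.
set Del : R := (maxdeg G)%:R in nD lL *.
have D1 : 32 <= Del by lra.
have Dd : delta0 <= Del by lra.
have Lam1 : 1 <= ln Del.
  rewrite -[leLHS]expRK ler_ln ?posrE ?expR_gt0 //; last lra.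
  by have := @expR1_le4 R; lra.
have KL1 : 1 <= K * ln Del by rewrite -[leLHS]mulr1; apply: ler_pM => //; lra.
have KL0 : 0 < K * ln Del by lra.
pose D u : R := Num.max (deg G u)%:R (delta0 * (K * ln Del)).
apply: (core V G k t D sG k3 t2 lp D1 _ _ _ HT H L cov) => u.
- by rewrite le_max lexx.
- by rewrite le_max lexx orbT.
- rewrite ge_max ler_wpM2r ?(ltW KL0) // andbT.
  apply: (@le_trans _ _ Del); last by rewrite ler_peMr //; lra.
  by rewrite ler_nat; exact: (@leq_bigmax _ (fun u => deg G u)).
apply: le_trans (lL u); rewrite ler_wpM2l ?addr_ge0 ?(ltW eps0) //.
rewrite le_max /D; have [_|_] := leP (delta0 * (K * ln Del)) (deg G u)%:R.
  by rewrite lexx.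
apply/orP; right; rewrite mulfK ?gt_eqF //.
by rewrite -[leRHS]mulrA [leLHS]mulrAC.
Qed.

(** Both K and log Delta are at most Delta^eta, so ln(Delta/(K log Delta)) >= (1 - 2 eta) log Delta.
    With eta = e/16 this loss and the factor 1 + e/4 fit into 1 + e/2; the remaining e/2 pays for
    rounding to an integer list size. *)
Lemma chi_c_bound (eps : R) : 0 < eps -> exists eta : R, 0 < eta /\ exists D : nat,
  forall (V : finType) (G : rel V) (k : nat) (t : R),
  simple_graph G -> (3 <= k)%N -> 1 / 2 <= t -> local_path_bound G k t ->
  (D <= maxdeg G)%N -> k%:R + Num.sqrt t <= (maxdeg G)%:R `^ eta ->
  chi_c R G <= (1 + eps) * ((maxdeg G)%:R / ln (maxdeg G)%:R).
Proof.
move=> eps0; pose e : R := Num.min eps 1; pose eta := e / 16.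
have e0 : 0 < e by rewrite lt_min eps0 ltr01.
have e1 : e <= 1 by rewrite ge_min lexx orbT.
have ee : e <= eps by rewrite ge_min lexx.
have eta0 : 0 < eta by rewrite divr_gt0.
have e40 : 0 < e / 4 by rewrite divr_gt0.
have [delta0 [d1 core]] := sparse_cover_colouring e40.
(* The summands ensure in turn Lam <= e^(eta Lam), the lower bound [dq] on Delta, and Delta/Lam >=
   2/e, which absorbs the rounding. *)
pose Lam0 := 4 / eta ^+ 2 + 2 * ln delta0 + 8 / e.
have [n nP] := archi_bound (32 + expR Lam0); exists eta; split=> //; exists n.
move=> V G k t sG k3 t2 lp /nP; set Del : R := (maxdeg G)%:R => nD.
have [_ [_ K3]] := sqrtD_bound k3 t2; set K := k%:R + Num.sqrt t in K3 *.
have LamP := expR_gt0 Lam0.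
have Del32 : 32 <= Del by lra.
have Del0 : 0 < Del by lra.
rewrite /powR (gt_eqF Del0); set Lam := ln Del => KDel.
have DelE : expR Lam = Del by rewrite lnK.
have LamL : Lam0 <= Lam by rewrite -[leLHS]expRK ler_ln ?posrE //; lra.
have lnd0 : 0 < ln delta0 by rewrite ln_gt0.
have p1 : 0 < 4 / eta ^+ 2 by rewrite divr_gt0 // exprn_gt0.
have p2 : 0 < 8 / e by rewrite divr_gt0.
have Lam_gt0 : 0 < Lam by apply: lt_le_trans LamL; rewrite /Lam0; lra.
have LamE : Lam <= expR (eta * Lam).
  apply: le_trans (expR_ge_sqr _); last by rewrite mulr_ge0 ?ltW.
  have -> : (eta * Lam) ^+ 2 / 4 = eta ^+ 2 / 4 * Lam * Lam by ring.
  rewrite ler_peMl ?(ltW Lam_gt0) //.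
  rewrite -ler_pdivrMl ?divr_gt0 ?exprn_gt0 // invf_div mulr1.
  by apply: le_trans LamL; rewrite /Lam0; lra.
have K0 : 0 < K by lra.
have KL0 : 0 < K * Lam by rewrite mulr_gt0.
have KL : K * Lam <= expR (2 * eta * Lam).
  have -> : 2 * eta * Lam = eta * Lam + eta * Lam by ring.
  by rewrite expRD; apply: ler_pM; rewrite // ltW.
have qE : expR ((1 - 2 * eta) * Lam) <= Del / (K * Lam).
  rewrite ler_pdivlMr //; apply: (@le_trans _ _ (expR ((1 - 2 * eta) * Lam) * expR (2 * eta * Lam))).
    by rewrite ler_wpM2l ?expR_ge0.
  by rewrite -expRD -DelE ler_expR le_eqVlt; apply/orP; left; apply/eqP; ring.
have q0 : 0 < Del / (K * Lam) by rewrite divr_gt0.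
have X : (1 - 2 * eta) * Lam <= ln (Del / (K * Lam)).
  by rewrite -[leLHS]expRK ler_ln ?posrE ?expR_gt0.
have eta2 : eta <= 1 / 16 by rewrite /eta; lra.
have X0 : 0 < (1 - 2 * eta) * Lam by rewrite mulr_gt0 //; lra.
have dq : delta0 * (K * Lam) <= Del.
  rewrite -ler_pdivlMr //; apply: le_trans qE.
  have d0 : 0 < delta0 by lra.
  rewrite -[leLHS](@lnK R delta0) ?posrE // ler_expR.
  have : 2 * ln delta0 <= Lam by apply: le_trans LamL; rewrite /Lam0; lra.
  nra.
have DL : 2 / e <= Del / Lam.
  rewrite ler_pdivlMr //; apply: (@le_trans _ _ (Lam ^+ 2 / 4)); last by rewrite -DelE expR_ge_sqr ?ltW.
  have -> : Lam ^+ 2 / 4 = Lam / 4 * Lam by ring.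
  rewrite ler_wpM2r ?(ltW Lam_gt0) //.
  have : 8 / e <= Lam by apply: le_trans LamL; rewrite /Lam0; lra.
  have -> : 8 / e = 4 * (2 / e) by ring.
  lra.
have r0 : 0 <= Del / Lam by rewrite divr_ge0 ?ltW.
have s0 : 0 <= (1 + eps) * (Del / Lam) by rewrite mulr_ge0 // addr_ge0 // ltW.
have [m [ml mu]] : exists m : nat, m%:R <= (1 + eps) * (Del / Lam) /\
    (1 + eps) * (Del / Lam) <= m%:R + 1.
  exists (Num.truncn ((1 + eps) * (Del / Lam))).
  by have /andP[-> /ltW] := truncn_itv s0; rewrite -natr1.
apply: le_trans ml; apply: inf_lbound.
  by exists 0 => x [j [-> _]].
exists m; split=> // HT H L cov Lm.
have KL1 : 1 <= K * Lam.
  have Lam1 : 1 <= Lam.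
    apply: le_trans LamL; rewrite /Lam0.
    have : 8 <= 8 / e by rewrite ler_pdivlMr // ler_piMr.
    lra.
  by rewrite -[leLHS]mulr1; apply: ler_pM => //; lra.
apply: (core V G k t (fun _ => Del) sG k3 t2 lp Del32 _ _ _ HT H L cov) => u.
- by rewrite ler_nat; exact: (@leq_bigmax _ (fun u => deg G u)).
- exact: dq.
- by rewrite ler_peMr // ltW.
rewrite Lm -/K -/Lam.
have le1 : (1 + e / 4) * (Del / ln (Del / (K * Lam))) <= (1 + e / 2) * (Del / Lam).
  apply: (@le_trans _ _ ((1 + e / 4) * (Del / ((1 - 2 * eta) * Lam)))).
    rewrite ler_wpM2l //; first by lra.
    rewrite ler_wpM2l ?(ltW Del0) // lef_pV2 ?posrE //.
    exact: lt_le_trans X0 X.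
  have -> : (1 + e / 4) * (Del / ((1 - 2 * eta) * Lam)) = (1 + e / 4) / (1 - 2 * eta) * (Del / Lam).
    by field; rewrite !gt_eqF //; lra.
  rewrite ler_wpM2r // ler_pdivrMr; last by lra.
  rewrite /eta; nra.
apply: le_trans le1 _.
have : e / 2 * (2 / e) <= e / 2 * (Del / Lam) by rewrite ler_wpM2l // divr_ge0 // ltW.
have -> : e / 2 * (2 / e) = 1 by field; rewrite gt_eqF.
have : e * (Del / Lam) <= eps * (Del / Lam) by rewrite ler_wpM2r.
lra.
Qed.

End CoverColouring.

Unset Implicit Arguments.
Local Open Scope classical_set_scope.

Theorem mainTheorem11 (R : realType) :
  (* (1) occupancy fraction bound *)
  (forall (V : finType) (G : rel V) (k : nat) (t : R),
     simple_graph G -> (3 <= k)%N -> 1 / 2 <= t -> local_path_bound G k t ->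
     (0 < #|V|)%N ->
     forall lam : R, 0 < lam ->
       sup [set y : R | exists x : R, 0 < x <= lam /\
              y = x / (1 + x) *
                  W_ratio ((maxdeg G)%:R * (1 + x) `^ (k%:R - 3 + Num.sqrt (2 * t))
                           * ln (1 + x))]
       <= (#|V|%:R)^-1 *
          (lam * ((indep_poly R G)^`()).[lam] / (indep_poly R G).[lam]))
  /\
  (* (2) local fractional colouring *)
  (forall eps : R, 0 < eps -> exists delta0 : R,
     forall (V : finType) (G : rel V) (k : nat) (t : R),
       simple_graph G -> (3 <= k)%N -> 1 / 2 <= t -> local_path_bound G k t ->
       exists w : {set V} -> set R, frac_colouring G w /\
         forall u : V, colour_of G w u `<=`
           [set x : R | 0 <= x < (1 + eps) *
              Num.max ((deg G u)%:R / ln ((deg G u)%:R / (k%:R + Num.sqrt t)))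
                      (delta0 / ln delta0 * (k%:R + Num.sqrt t))])
  /\
  (* (2') chi_f(G) <= (1 + o(1)) Delta / log(Delta / (k + sqrt t))
          as Delta / (k + sqrt t) -> oo *)
  (forall eps : R, 0 < eps -> exists C : R,
     forall (V : finType) (G : rel V) (k : nat) (t : R),
       simple_graph G -> (3 <= k)%N -> 1 / 2 <= t -> local_path_bound G k t ->
       C <= (maxdeg G)%:R / (k%:R + Num.sqrt t) ->
       chi_f R G <= (1 + eps) * ((maxdeg G)%:R /
                                 ln ((maxdeg G)%:R / (k%:R + Num.sqrt t))))
  /\
  (* (3) local correspondence colouring *)
  (forall eps : R, 0 < eps -> exists (delta0 : R) (Delta0 : nat),
     forall (V : finType) (G : rel V) (k : nat) (t : R),
       simple_graph G -> (3 <= k)%N -> 1 / 2 <= t -> local_path_bound G k t ->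
       (Delta0 <= maxdeg G)%N ->
       forall (HT : finType) (H : rel HT) (L : V -> {set HT}),
         dp_cover G H L ->
         (forall u : V,
            (1 + eps) *
              Num.max ((deg G u)%:R /
                         ln ((deg G u)%:R /
                             ((k%:R + Num.sqrt t) * ln (maxdeg G)%:R)))
                      (delta0 / ln delta0 * (k%:R + Num.sqrt t) * ln (maxdeg G)%:R)
            <= (#|L u|)%:R) ->
         cover_colourable V H)
  /\
  (* (3') if k + sqrt t = Delta^{o(1)} then chi_c(G) <= (1 + o(1)) Delta / log Delta
          as Delta -> oo *)
  (forall eps : R, 0 < eps -> exists eta : R, 0 < eta /\ exists D : nat,
     forall (V : finType) (G : rel V) (k : nat) (t : R),
       simple_graph G -> (3 <= k)%N -> 1 / 2 <= t -> local_path_bound G k t ->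
       (D <= maxdeg G)%N ->
       k%:R + Num.sqrt t <= (maxdeg G)%:R `^ eta ->
       chi_c R G <= (1 + eps) * ((maxdeg G)%:R / ln (maxdeg G)%:R)).
Proof.
split; first by move=> V G k t sG k3 _ lp V0 lam lam0; apply: occupancy_sup.
split; first exact: local_frac_colouring.
split; first exact: chi_f_bound.
split; first exact: local_cover_colouring.
exact: chi_c_bound.
Qed.
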